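(* Let $A\subset\mathbb R^q$ be a Borel set with $p_A:=\mathbb P(\mathbf Z\in A)>0$ and assume Condition (C) below holds. Then $$\sup_{\mathbf u\in[0,1]^p}\big|\overline{\mathbb D}_n(\mathbf u,A)-\widetilde{\mathbb D}_n(\mathbf u,A)\big|\longrightarrow 0\quad\text{in probability as } n\to\infty,$$ where $$\widetilde{\mathbb D}_n(\mathbf u,A):=\mathbb D_n(\mathbf u,A)-p_A^{-1}\sum_{k=1}^p\partial_kD(\mathbf u,A)\Big(\mathbb D_n\big((u_k,\mathbf 1_{-k}),A\big)-u_k\,\mathbb D_n(\mathbf 1,A)\Big).$$
   Context: Let $(\mathbf X,\mathbf Z)$ be a random vector in $\mathbb R^p\times\mathbb R^q$ and $(\mathbf X_1,\mathbf Z_1),\dots,(\mathbf X_n,\mathbf Z_n)$ i.i.d. copies of it. Vector inequalities are componentwise. For a Borel set $A$ with $p_A>0$, the conditional margins $F_k(t|A):=\mathbb P(X_k\le t\mid \mathbf Z\in A)$, $k=1,\dots,p$, are assumed continuous (standing assumption). Let $U^A_k:=F_k(X_k|A)$, $\mathbf U^A=(U^A_1,\dots,U^A_p)$, $U^A_{i,k}:=F_k(X_{i,k}|A)$, $\mathbf U^A_i=(U^A_{i,1},\dots,U^A_{i,p})$, and $D(\mathbf u,A):=\mathbb P(\mathbf U^A\le\mathbf u,\mathbf Z\in A)$ for $\mathbf u\in[0,1]^p$. Let $n_A:=\sum_{i=1}^n\mathbf 1(\mathbf Z_i\in A)$, $D_n(\mathbf u,A):=n^{-1}\sum_{i=1}^n\mathbf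 1(\mathbf U^A_i\le\mathbf u,\mathbf Z_i\in A)$, $\mathbb D_n(\mathbf u,A):=\sqrt n(D_n-D)(\mathbf u,A)$, $G_{n,k}(u|A):=n_A^{-1}\sum_{i=1}^n\mathbf 1(U^A_{i,k}\le u,\mathbf Z_i\in A)$ (set to $0$ if $n_A=0$), with generalized inverse $G^{-1}(u):=\inf\{t: G(t)\ge u\}$, $\overline D_n(\mathbf u,A):=n^{-1}\sum_{i=1}^n\mathbf 1\big(U^A_{i,k}\le G_{n,k}^{-1}(u_k|A)\ \forall k,\ \mathbf Z_i\in A\big)$, and $\overline{\mathbb D}_n(\mathbf u,A):=\sqrt n(\overline D_n-D)(\mathbf u,A)$. The vector $(u_k,\mathbf 1_{-k})$ has $k$-th coordinate $u_k$ and all other coordinates equal to $1$; $\mathbf 1=(1,\dots,1)$. $\partial_kD(\mathbf u,A)$ is the partial derivative of $\mathbf u\mapsto D(\mathbf u,A)$ w.r.t. $u_k$. Condition (C): for every $k\in\{1,\dots,p\}$, $\partial_kD(\cdot,A)$ exists and is continuous on $V_k:=\{\mathbf u\in[0,1]^p:0<u_k<1\}$. *)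

(* Defs.v *)
From HB Require Import structures.
From mathcomp Require Import all_boot all_order all_algebra.
From mathcomp Require Import all_classical all_reals all_analysis.
Set Implicit Arguments. Unset Strict Implicit. Unset Printing Implicit Defensive.
Import Order.TTheory GRing.Theory Num.Theory.
Import numFieldNormedType.Exports.
Local Open Scope classical_set_scope.
Local Open Scope ring_scope.

Section Defs.
Variables (d : measure_display) (T : measurableType d) (R : realType).
Variable (P : probability T R).
Variables (p q : nat).

Definition borel_rV (m : nat) : set (set 'rV[R]_m) := <<s open >>.

Definition random_vector (m : nat) (Y : T -> 'rV[R]_m) : Prop :=
  forall B, borel_rV B -> measurable (Y @^-1` B).

Definition Pr (E : set T) : R := fine (P E).

Definition joint (X : T -> 'rV[R]_p) (Z : T -> 'rV[R]_q) : T -> 'rV[R]_(p + q) :=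
  fun w => row_mx (X w) (Z w).

Definition iid_copies (X : T -> 'rV[R]_p) (Z : T -> 'rV[R]_q)
  (Xs : nat -> T -> 'rV[R]_p) (Zs : nat -> T -> 'rV[R]_q) : Prop :=
  random_vector (joint X Z) /\
  (forall i, random_vector (joint (Xs i) (Zs i))) /\
  (forall i B, borel_rV B ->
     P (joint (Xs i) (Zs i) @^-1` B) = P (joint X Z @^-1` B)) /\
  (forall (s : seq nat) (B : nat -> set 'rV[R]_(p + q)), uniq s ->
     (forall i, borel_rV (B i)) ->
     Pr [set w | forall i, i \in s -> B i (joint (Xs i) (Zs i) w)] =
     \prod_(i <- s) Pr (joint (Xs i) (Zs i) @^-1` B i)).

Variables (X : T -> 'rV[R]_p) (Z : T -> 'rV[R]_q)
  (Xs : nat -> T -> 'rV[R]_p) (Zs : nat -> T -> 'rV[R]_q) (A : set 'rV[R]_q).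

Definition pA : R := Pr (Z @^-1` A).

Definition Fcond (k : 'I_p) (t : R) : R :=
  Pr [set w | X w ord0 k <= t /\ A (Z w)] / pA.

Definition UA (k : 'I_p) (w : T) : R := Fcond k (X w ord0 k).
Definition UAi (i : nat) (k : 'I_p) (w : T) : R := Fcond k (Xs i w ord0 k).

Definition Dfun (u : 'rV[R]_p) : R :=
  Pr [set w | (forall k, UA k w <= u ord0 k) /\ A (Z w)].

Definition ukone (u : 'rV[R]_p) (k : 'I_p) : 'rV[R]_p :=
  \row_j (if j == k then u ord0 k else 1).
Definition onevec : 'rV[R]_p := \row_j 1.

Definition ek (k : 'I_p) : 'rV[R]_p := \row_j (j == k)%:R.
Definition dD (k : 'I_p) (u : 'rV[R]_p) : R := 'D_(ek k) Dfun u.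

Definition Vk (k : 'I_p) : set 'rV[R]_p :=
  [set u | (forall j, 0 <= u ord0 j <= 1) /\ 0 < u ord0 k < 1].

Definition condC : Prop :=
  forall k : 'I_p,
    (forall u, Vk k u -> derivable Dfun u (ek k)) /\
    {within Vk k, continuous (dD k)}.

Definition nA (n : nat) (w : T) : nat := \sum_(i < n) (Zs i w \in A).

Definition Dn (n : nat) (u : 'rV[R]_p) (w : T) : R :=
  (n%:R)^-1 * \sum_(i < n)
     ([forall k, UAi i k w <= u ord0 k] && (Zs i w \in A))%:R.
Definition DDn (n : nat) (u : 'rV[R]_p) (w : T) : R :=
  Num.sqrt (n%:R) * (Dn n u w - Dfun u).

Definition Gnk (n : nat) (k : 'I_p) (w : T) (t : R) : R :=
  if nA n w == 0%N then 0 else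
  ((nA n w)%:R)^-1 * \sum_(i < n) ((UAi i k w <= t) && (Zs i w \in A))%:R.
Definition Gnk_inv (n : nat) (k : 'I_p) (w : T) (v : R) : \bar R :=
  ereal_inf [set t%:E | t in [set t : R | v <= Gnk n k w t]].

Definition Dbarn (n : nat) (u : 'rV[R]_p) (w : T) : R :=
  (n%:R)^-1 * \sum_(i < n)
     ([forall k, ((UAi i k w)%:E <= Gnk_inv n k w (u ord0 k))%E]
        && (Zs i w \in A))%:R.
Definition DDbarn (n : nat) (u : 'rV[R]_p) (w : T) : R :=
  Num.sqrt (n%:R) * (Dbarn n u w - Dfun u).

Definition DDtilden (n : nat) (u : 'rV[R]_p) (w : T) : R :=
  DDn n u w - pA^-1 * \sum_(k < p)
     dD k u * (DDn n (ukone u k) w - u ord0 k * DDn n onevec w).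

End Defs.

Definition unit_cube (R : realType) (p : nat) : set 'rV[R]_p :=
  [set u | forall j, 0 <= u ord0 j <= 1].

(* Convergence in (outer) probability to 0 of sup_{u in [0,1]^p} |Y n u|:
   for all eps, delta > 0, eventually the event {sup_u |Y n u| > eps}
   = {exists u, |Y n u| > eps} is contained in an event of probability
   at most delta. *)
Definition sup_cvg_in_prob0 d (T : measurableType d) (R : realType)
  (P : probability T R) (p : nat) (Y : nat -> 'rV[R]_p -> T -> R) : Prop :=
  forall eps delta : R, 0 < eps -> 0 < delta ->
    \forall n \near \oo, exists E : set T,
      measurable E /\
      [set w | exists2 u, @unit_cube R p u & eps < `|Y n u w|] `<=` E /\
      (P E <= delta%:E)%E.

(* Main.v *)
Require Import Defs.
From HB Require Import structures.
From mathcomp Require Import all_boot all_order all_algebra.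
From mathcomp Require Import all_classical all_reals all_analysis.
From mathcomp Require Import ring lra zify.
Import Order.TTheory GRing.Theory Num.Theory.
Import numFieldNormedType.Exports.
Set Implicit Arguments. Unset Strict Implicit. Unset Printing Implicit Defensive.
Local Open Scope classical_set_scope.
Local Open Scope ring_scope.

(** On the unit cube, [DDbarn] at [u] is [DDn] at [v] plus
    [sqrt n * (Dfun v - Dfun u)], where [v] collects the empirical quantiles
    [Gnk_inv] at [u]. Two properties of [DDn], valid outside an event of small
    probability, suffice: it is bounded, and it has a small modulus of
    continuity. Both come from dyadic chaining: the increment of [DDn] between
    neighbouring grid points at level [j] is a centred binomial of variance
    [O(2^-j)], so Chernoff's bound gives a failure probability
    [exp (- C K^2 (9/8)^j)] for the threshold [K (3/4)^j], which beats the
    number of grid pairs; the chain is stopped at mesh about [n^(-3/4)], finer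
    than [n^(-1/2)], and monotonicity does the rest. The modulus of continuity
    inverts the marginal empirical distribution functions,
    [sqrt n pA (v_k - u_k) = - (DDn (u_k, 1) - u_k DDn 1) + o(1)] uniformly, and
    the mean value theorem, one coordinate at a time, turns
    [sqrt n (Dfun v - Dfun u)] into the derivative terms. Near the faces
    [u_k = 0] and [u_k = 1], where the derivatives need not be continuous, the
    factor [DDn (u_k, 1) - u_k DDn 1] is itself small. *)

(** * Exponential inequalities and the total failure probability of the chaining *)

Section ExpBounds.
Variable R : realType.

(** From [expR (- x) >= 1 - x] follows [expR x * (1 - x) <= 1], while [(1 + x + 2 x^2)(1 - x) = 1 +
    x^2 (1 - 2 x) >= 1]. Negative [x] of any size is allowed, so the same bound serves both tails of
    the Chernoff estimate. *)
Lemma expR_le_quadratic (x : R) : x <= 2^-1 -> expR x <= 1 + x + 2 * x ^+ 2.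
Proof.
move=> hx.
have h1 : 0 < 1 - x by lra.
have h2 := expR_ge1Dx (- x).
have h3 : expR x * (1 - x) <= 1.
  by rewrite -[leRHS](expRxMexpNx_1 x) ler_pM2l ?expR_gt0.
have h4 : 1 <= (1 + x + 2 * x ^+ 2) * (1 - x) by nra.
by rewrite -(ler_pM2r h1); exact: le_trans h3 h4.
Qed.

(** Raise [y / N <= expR (y / N)] to the power [N]. With [N] at choice, exponential decay becomes
    polynomial decay of any degree. *)
Lemma expRN_le_pow (N : nat) (y : R) : (0 < N)%N -> 0 < y ->
  expR (- y) <= (N%:R / y) ^+ N.
Proof.
move=> N0 y0.
have N0' : 0 < N%:R :> R by rewrite ltr0n.
have h : (y / N%:R) ^+ N <= expR y.
  rewrite -{2}(@divfK _ N%:R _ y) ?gt_eqF // expRM_natr.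
  rewrite lerXn2r ?nnegrE ?expR_ge0 ?divr_ge0 ?ltW //.
  by apply: lt_le_trans (expR_ge1Dx _); rewrite ltrDr.
rewrite expRN -(invf_div y) exprVn lef_pV2 ?posrE ?expR_gt0 //.
by rewrite exprn_gt0 // divr_gt0.
Qed.

Lemma sum_geometric_half (J : nat) : \sum_(j < J) (2^-1 : R) ^+ j <= 2.
Proof.
suff -> : \sum_(j < J) (2^-1 : R) ^+ j = 2 - 2 * 2^-1 ^+ J.
  by rewrite gerBl mulr_ge0 // exprn_ge0 // invr_ge0.
elim: J => [|J IH]; first by rewrite big_ord0 expr0; lra.
by rewrite big_ord_recr /= IH exprS; lra.
Qed.

(** The number of grid pairs grows like [(4^p)^j]; a large enough power of [(9/8)^j], obtained from
    the exponential, turns the sum into a geometric series of ratio 1/2. The constant [K] does not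
    depend on the number of levels. *)
Lemma chaining_tail_small (p : nat) (c delta : R) : 0 < c -> 0 < delta ->
  exists2 K : R, 0 < K & forall J,
    \sum_(j < J) 2 * (((2 ^ j).+1 ^ p) ^ 2)%:R
       * expR (- (K ^+ 2 * (9 / 8) ^+ j / c)) <= delta.
Proof.
move=> c0 d0.
(* Since [(9/8)^12 >= 4] and [(9/8)^6 >= 2], this exponent gives [(9/8)^N >= 2 * 4^p]. The factor
   [B] then brings the series, at most [4 * 4^p / B], below [delta]. *)
pose N := (12 * p + 6)%N.
have N0 : (0 < N)%N by rewrite /N addnS.
have N0' : 0 < N%:R :> R by rewrite ltr0n.
pose B : R := 4 * 4 ^+ p / delta + 1.
have p4 : 0 < 4 ^+ p :> R by rewrite exprn_gt0.
have B1 : 1 <= B by rewrite /B lerDr divr_ge0 ?mulr_ge0 ?ltW.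
have B0 : 0 < B by lra.
exists (Num.sqrt (N%:R * c * B)); first by rewrite sqrtr_gt0 !mulr_gt0.
move=> J; rewrite sqr_sqrtr; last by rewrite !mulr_ge0 // ltW.
apply: (@le_trans _ _ (\sum_(j < J) 2 * 4 ^+ p / B * 2^-1 ^+ j)); last first.
  rewrite -mulr_sumr; apply: (@le_trans _ _ (2 * 4 ^+ p / B * 2)).
    by rewrite ler_wpM2l ?sum_geometric_half // ?divr_ge0 ?mulr_ge0 ?ltW.
  rewrite mulrAC ler_pdivrMr // /B.
  have := @divfK _ delta (lt0r_neq0 d0) (4 * 4 ^+ p).
  by move: (_ / delta) => z hz; lra.
apply: ler_sum => j _.
set q := (9 / 8 : R) ^+ j.
have q0 : 0 < q by rewrite exprn_gt0 //; lra.
have y0 : 0 < N%:R * c * B * q / c by rewrite divr_gt0 // !mulr_gt0.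
have := expRN_le_pow N0 y0.
have -> : N%:R / (N%:R * c * B * q / c) = (B * q)^-1.
  by field; rewrite !gt_eqF.
move=> h1.
have h2 : (((2 ^ j).+1 ^ p) ^ 2)%:R <= 4 ^+ p * (4 ^+ p) ^+ j :> R.
  rewrite (_ : 4 = (2 ^ 2)%:R) // -!natrX -natrM ler_nat.
  apply: (@leq_trans (((2 ^ j.+1) ^ p) ^ 2)).
    rewrite leq_exp2r //; case: (p) => // p'; rewrite leq_exp2r // expnS.
    by have := expn_gt0 2 j; lia.
  by rewrite -!expnM -expnD leq_pexp2l //; lia.
have h3 : 4 ^+ p <= 2^-1 * (9 / 8) ^+ N :> R.
  rewrite /N exprD exprM.
  have a1 : 2 <= (9 / 8) ^+ 6 :> R by lra.
  have a2 : 4 <= (9 / 8) ^+ 12 :> R by lra.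
  have a3 : 4 ^+ p <= ((9 / 8) ^+ 12) ^+ p :> R.
    by rewrite lerXn2r ?nnegrE // exprn_ge0.
  have : ((9 / 8) ^+ 12) ^+ p * 2 <= ((9 / 8) ^+ 12) ^+ p * (9 / 8) ^+ 6 :> R.
    by rewrite ler_wpM2l // !exprn_ge0.
  by lra.
have h4 : (4 ^+ p) ^+ j <= 2^-1 ^+ j * q ^+ N :> R.
  have -> : q ^+ N = ((9 / 8) ^+ N) ^+ j by rewrite /q -!exprM mulnC.
  by rewrite -exprMn lerXn2r // nnegrE ?mulr_ge0 ?exprn_ge0.
have h5 : (B * q)^-1 ^+ N <= B^-1 * (q ^+ N)^-1.
  rewrite invfM exprMn !exprVn ler_wpM2r ?invr_ge0 ?exprn_ge0 // ?(ltW q0) //.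
  rewrite lef_pV2 ?posrE ?exprn_gt0 // -{1}(expr1 B) ler_weXn2l //.
apply: (@le_trans _ _ (2 * (4 ^+ p * (2^-1 ^+ j * q ^+ N)) * (B^-1 * (q ^+ N)^-1))).
  apply: ler_pM => //; rewrite ?mulr_ge0 ?expR_ge0 //.
    rewrite ler_wpM2l //; apply: le_trans h2 _.
    by rewrite ler_wpM2l // ltW.
  exact: le_trans h1 h5.
have qN : q ^+ N != 0 by rewrite gt_eqF // exprn_gt0.
rewrite le_eqVlt; apply/orP; left; apply/eqP; field; by rewrite qN gt_eqF.
Qed.
End ExpBounds.

(** * Chernoff bound for independent events *)

Section FiniteUnion.
Context {d : measure_display} {T : measurableType d} {R : realType}.
Variable P : probability T R.

Lemma measure_bigcup_fin_le (I : finType) (F : I -> set T) (b : I -> R) :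
  (forall i, measurable (F i)) -> (forall i, (P (F i) <= (b i)%:E)%E) ->
  (P (\bigcup_i F i) <= (\sum_i b i)%:E)%E.
Proof.
move=> mF hb.
(* Boole's inequality speaks of sequences, so the family is enumerated and padded with the empty
   set. *)
pose G (n : nat) : set T := nth set0 [seq F i | i <- enum I] n.
have mG n : measurable (G n).
  rewrite /G; case: (ltnP n (size [seq F i | i <- enum I])) => h; last first.
    by rewrite nth_default.
  have /mapP[i _ ->] := mem_nth set0 h; exact: mF.
have -> : \bigcup_i F i = \big[setU/set0]_(n < #|I|) G n.
  rewrite -bigcup_mkord; apply/seteqP; split => w.
    case=> i _ Fi; exists (enum_rank i) => /=; first exact: ltn_ord.
    by rewrite /G (nth_map i) ?nth_enum_rank // -cardE ltn_ord.
  case=> n /= nI; rewrite /G.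
  case: (pickP (pred_of_simpl (@predT I))) => [i0 _|h0]; last first.
    by move: nI; rewrite eq_card0.
  by rewrite (nth_map i0) -?cardE // => h; exists (nth i0 (enum I) n).
apply: (le_trans (Boole_inequality P (A := G) (fun i _ => mG i))).
rewrite -sumEFin.
apply: (@le_trans _ _ (\sum_(i <- [seq F i | i <- enum I]) P i)%E).
  by rewrite (big_nth set0) size_map -cardE big_mkord.
rewrite big_map big_enum /=.
by apply: lee_sum => i _; exact: hb.
Qed.
End FiniteUnion.

Section Chernoff.
Context {d : measure_display} {T : measurableType d} {R : realType}.
Variable P : probability T R.
Variables (n : nat) (E : 'I_n -> set T) (b : R).
Hypothesis mE : forall i, measurable (E i).
Hypothesis b01 : 0 <= b <= 1.
Hypothesis iidE : forall c : {ffun 'I_n -> bool},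
  P [set w | forall i, (w \in E i) = c i] =
  (\prod_(i < n) (if c i then b else 1 - b))%:E.

Let atom (c : {ffun 'I_n -> bool}) := [set w | forall i, (w \in E i) = c i].

Let measurable_atom c : measurable (atom c).
Proof.
have -> : atom c = \bigcap_(i in [set: 'I_n]) (if c i then E i else ~` E i).
  apply/seteqP; split => w h i.
    move=> _; have := h i; case: (c i) => /= [/set_mem //|].
    by move=> h1 /mem_set; rewrite h1.
  have := h i I; case: (c i) => /= h1; first exact/mem_set.
  by apply/negbTE; apply/negP => /set_mem.
apply: fin_bigcap_measurable => //= i _.
by case: (c i) => //; exact: measurableC.
Qed.

(** Exponential Markov inequality without integrals: the event is a finite disjoint union of
    patterns of successes, each of explicit probability, and [1 <= expR (lam * (S - n b) - t)] on
    every pattern that occurs. Both signs of [lam] are allowed, one for each tail. *)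
Lemma chernoff (lam t : R) : lam <= 2^-1 ->
  let B := [set w | t <= lam * (\sum_(i < n) (w \in E i)%:R - n%:R * b)] in
  measurable B /\ (P B <= (expR (- t + 2 * n%:R * b * lam ^+ 2))%:E)%E.
Proof.
move=> hlam B; have /andP[b0 b1] := b01.
pose G (c : {ffun 'I_n -> bool}) := if t <= lam * (\sum_(i < n) (c i)%:R - n%:R * b) then atom c else set0.
pose g (c : {ffun 'I_n -> bool}) : R := expR (lam * (\sum_(i < n) (c i)%:R - n%:R * b) - t)
   * \prod_(i < n) (if c i then b else 1 - b).
have mG c : measurable (G c).
  by rewrite /G; case: ifP => _ //; exact: measurable_atom.
have prod_ge0 (c : {ffun 'I_n -> bool}) :
    0 <= \prod_(i < n) (if c i then b else 1 - b).
  by apply: prodr_ge0 => i _; case: ifP => _; lra.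
have hG c : (P (G c) <= (g c)%:E)%E.
  rewrite /G; case: ifP => h.
    rewrite iidE lee_fin /g -[leLHS]mul1r ler_wpM2r //.
    by apply: le_trans (expR_ge1Dx _); rewrite lerDl subr_ge0.
  by rewrite measure0 lee_fin mulr_ge0 // expR_ge0.
have BE : B = \bigcup_c G c.
  apply/seteqP; split => w.
    rewrite /B /= => h; exists [ffun i => w \in E i] => //.
    rewrite /G; under eq_bigr do rewrite ffunE.
    by rewrite h /atom /= => i; rewrite ffunE.
  case=> c _; rewrite /G; case: ifP => // h.
  rewrite /atom /B /= => hc.
  by under eq_bigr do rewrite hc.
rewrite BE; split.
  by apply: fin_bigcup_measurable => //; exact: finite_finset.
apply: (le_trans (measure_bigcup_fin_le mG hG)).
rewrite lee_fin.
(* Distributivity turns the sum over patterns of products into the [n]-th power of the moment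
   generating function of one trial. *)
have -> : \sum_c g c = expR (- t - lam * n%:R * b) * (1 - b + b * expR lam) ^+ n.
  have -> : (1 - b + b * expR lam) ^+ n =
      \prod_(i < n) \sum_(e : bool) (if e then b else 1 - b) * expR (lam * e%:R).
    rewrite -[n in LHS]card_ord -prodr_const; apply: eq_bigr => i _.
    by rewrite big_bool /= mulr1 mulr0 expR0; ring.
  rewrite bigA_distr_bigA /= mulr_sumr; apply: eq_bigr => c _.
  rewrite /g big_split /= -expR_sum mulrCA -expRD mulrC.
  congr (_ * _); congr expR.
  by rewrite -mulr_sumr; ring.
rewrite [leRHS](_ : _ = expR (- t - lam * n%:R * b) *
    expR (n%:R * (b * (lam + 2 * lam ^+ 2)))); last first.
  by rewrite -expRD; congr expR; ring.
rewrite ler_wpM2l ?expR_ge0 // expRM_natl.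
have e0 := expR_gt0 lam.
rewrite lerXn2r ?nnegrE ?expR_ge0 //; first by nra.
apply: le_trans (expR_ge1Dx _).
have := expR_le_quadratic hlam; nra.
Qed.
End Chernoff.

(** * Orthants and uniform margins *)

Section Borel.
Variable R : realType.

(** The sets with Borel preimage form a sigma-algebra that contains the open sets. *)
Lemma borel_rV_preimage (m m' : nat) (f : 'rV[R]_m -> 'rV[R]_m') (B : set 'rV[R]_m') :
  continuous f -> borel_rV B -> borel_rV (f @^-1` B).
Proof.
move=> cf hB.
suff h : <<s @open 'rV[R]_m' >> `<=` [set C | <<s open >> (f @^-1` C)] by exact: h.
apply: smallest_sub; last first.
  by move=> C oC; apply: sub_sigma_algebra; apply: open_comp oC => x _; exact: cf.
split => /=.
- by rewrite preimage_set0; exact: sigma_algebra0.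
- move=> C hC; rewrite setTD preimage_setC; exact: sigma_algebraC.
- move=> C hC; rewrite preimage_bigcup; exact: sigma_algebra_bigcup.
Qed.

Lemma closed_borel_rV (m : nat) (B : set 'rV[R]_m) : closed B -> borel_rV B.
Proof.
move=> cB; rewrite -(setCK B); apply: sigma_algebraC; apply: sub_sigma_algebra.
exact/closed_openC.
Qed.

Lemma borel_rV_setI (m : nat) (B C : set 'rV[R]_m) :
  borel_rV B -> borel_rV C -> borel_rV (B `&` C).
Proof.
move=> hB hC.
exact: (@measurableI _ (g_sigma_algebraType (@open 'rV[R]_m))).
Qed.

Lemma borel_rV_setD (m : nat) (B C : set 'rV[R]_m) :
  borel_rV B -> borel_rV C -> borel_rV (B `\` C).
Proof.
move=> hB hC.
exact: (@measurableD _ (g_sigma_algebraType (@open 'rV[R]_m))).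
Qed.

Lemma borel_rV_setC (m : nat) (B : set 'rV[R]_m) : borel_rV B -> borel_rV (~` B).
Proof. exact: sigma_algebraC. Qed.

Lemma continuous_rsubmx (m m' : nat) :
  continuous (@rsubmx R 1 m m' : 'rV[R]_(m + m') -> 'rV[R]_m').
Proof.
move=> x. 
suff h : (forall e : R, 0 < e -> \forall y \near x, ball (rsubmx x) e (rsubmx y)).
  have FF := @nbhs_filter _ x.
  by move/(@cvg_ballP _ _ _ (nbhs x) FF (@rsubmx R 1 m m') (rsubmx x)): h.
move=> e e0.
apply: filterS (nbhsx_ballx x e e0) => y [_ xy].
by split => // i j; rewrite !mxE.
Qed.

End Borel.

Section Margins.
Context (d : measure_display) (T : measurableType d) (R : realType)
  (P : probability T R) (p q : nat)
  (X : T -> 'rV[R]_p) (Z : T -> 'rV[R]_q) (A : set 'rV[R]_q).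
Hypothesis rvXZ : random_vector (joint X Z).
Hypothesis borelA : borel_rV A.
Hypothesis pA0 : 0 < pA P Z A.
Hypothesis contF : forall k, continuous (Fcond P X Z A k).

Local Notation F := (Fcond P X Z A).
Local Notation D := (Dfun P X Z A).
Local Notation pA := (pA P Z A).

(** Phrased in the space of the vector [(X, Z)], so that [D] and the summands of [D_n] all come from
    preimages of one Borel set; equality in law and independence then apply directly. *)
Definition orthant (u : 'rV[R]_p) : set 'rV[R]_(p + q) :=
  [set x : 'rV[R]_(p + q) | (forall k, F k (x ord0 (lshift q k)) <= u ord0 k) /\ A (rsubmx x)].

Lemma PrE (E : set T) : measurable E -> P E = (Pr P E)%:E.
Proof. by move=> mE; rewrite /Pr fineK // fin_num_measure. Qed.

Lemma Pr_le (E E' : set T) : measurable E -> measurable E' -> E `<=` E' ->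
  Pr P E <= Pr P E'.
Proof. by move=> mE mE' EE'; rewrite -lee_fin -!PrE // le_measure ?inE. Qed.

Lemma Pr_setD (E E' : set T) : measurable E -> measurable E' -> E `<=` E' ->
  Pr P (E' `\` E) = Pr P E' - Pr P E.
Proof.
move=> mE mE' EE'; have mD := measurableD mE' mE.
apply: EFin_inj; rewrite EFinB -!PrE // measureD //.
  by rewrite setIC (setIidl EE').
by rewrite -ge0_fin_numE // fin_num_measure.
Qed.

Lemma borel_rV_cond : borel_rV [set x : 'rV[R]_(p + q) | A (rsubmx x)].
Proof. exact: (borel_rV_preimage (@continuous_rsubmx R p q) borelA). Qed.

Lemma borel_rV_orthant u : borel_rV (orthant u).
Proof.
have -> : orthant u = (\bigcap_(k in [set: 'I_p])
    [set x : 'rV[R]_(p + q) | F k (x ord0 (lshift q k)) <= u ord0 k])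
    `&` [set x | A (rsubmx x)].
  by apply/seteqP; split => x [h1 h2]; split => // k *; apply: h1.
apply: borel_rV_setI borel_rV_cond.
apply: (@fin_bigcap_measurable _ (g_sigma_algebraType (@open 'rV[R]_(p + q)))) => //.
move=> k _; apply: closed_borel_rV.
apply: (@closed_comp _ _ (fun x : 'rV[R]_(p + q) => F k (x ord0 (lshift q k)))
  [set y | y <= u ord0 k]); last exact: closed_le.
move=> x _; apply: (@continuous_comp _ _ _ (fun x : 'rV[R]_(p + q) => x ord0 (lshift q k)) (F k)).
  exact: coord_continuous.
exact: contF.
Qed.

Lemma joint_orthant (X' : T -> 'rV[R]_p) (Z' : T -> 'rV[R]_q) u :
  joint X' Z' @^-1` orthant u =
  [set w | (forall k, F k (X' w ord0 k) <= u ord0 k) /\ A (Z' w)].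
Proof.
apply/seteqP; split => w; rewrite /joint /orthant /= row_mxKr => -[h1 h2];
  by split => // k; have := h1 k; rewrite row_mxEl.
Qed.

Lemma DfunE u : D u = Pr P (joint X Z @^-1` orthant u).
Proof. by rewrite joint_orthant. Qed.

Lemma measurable_coord_le k t :
  measurable [set w | X w ord0 k <= t /\ A (Z w)].
Proof.
rewrite (_ : [set w | _] = joint X Z @^-1`
    ([set x : 'rV[R]_(p + q) | x ord0 (lshift q k) <= t] `&` [set x | A (rsubmx x)])).
  apply: rvXZ; apply: borel_rV_setI borel_rV_cond; apply: closed_borel_rV.
  apply: (@closed_comp _ _ (fun x : 'rV[R]_(p + q) => x ord0 (lshift q k))
    [set y | y <= t]); last exact: closed_le.
  by move=> x _; exact: coord_continuous.
by apply/seteqP; split => w; rewrite /joint /= row_mxKr row_mxEl.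
Qed.

Lemma measurable_cond : measurable (Z @^-1` A).
Proof.
rewrite (_ : Z @^-1` A = joint X Z @^-1` [set x | A (rsubmx x)]).
  exact: rvXZ borel_rV_cond.
by apply/seteqP; split => w; rewrite /joint /= row_mxKr.
Qed.

Lemma Fcond_nondecreasing k s t : s <= t -> F k s <= F k t.
Proof.
move=> st; rewrite /Fcond ler_wpM2r ?invr_ge0 ?(ltW pA0) //.
apply: Pr_le; try exact: measurable_coord_le.
by move=> w [h1 h2]; split => //; exact: le_trans h1 st.
Qed.

Lemma Fcond_le1 k t : F k t <= 1.
Proof.
rewrite /Fcond ler_pdivrMr // mul1r; apply: Pr_le.
- exact: measurable_coord_le.
- exact: measurable_cond.
- by move=> w [].
Qed.

(** Continuity of the measure from above along the events [X_k <= - m], which decrease to the empty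
    set. *)
Lemma Fcond_lt k e : 0 < e -> exists t, F k t < e.
Proof.
move=> e0.
pose B (m : nat) := [set w | X w ord0 k <= - m%:R /\ A (Z w)].
have mB m : measurable (B m) by exact: measurable_coord_le.
have B0 : \bigcap_m B m = set0.
  apply/seteqP; split => // w h.
  have hm := archi_boundP (normr_ge0 (X w ord0 k)).
  have [h1 _] := h (Num.bound `|X w ord0 k|) I.
  have := ler_norm (- X w ord0 k); rewrite normrN => h2.
  by lra.
have : P \o B @ \oo --> P (\bigcap_m B m).
  apply: nonincreasing_cvg_mu => //.
  - by rewrite -ge0_fin_numE // fin_num_measure.
  - by rewrite B0.
  - move=> m m' mm'; apply/subsetPset => w [h1 h2]; split => //.
    by apply: le_trans h1 _; rewrite lerN2 ler_nat.
rewrite B0 measure0 => h.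
have e1 : (0 < (e * pA)%:E :> \bar R)%E by rewrite lte_fin mulr_gt0.
have /h [m _ hm] := open_ereal_lt' e1.
exists (- m%:R); have := hm m (leqnn m).
by rewrite /= PrE // lte_fin /Fcond ltr_pdivrMr.
Qed.

Lemma Fcond_gt k e : e < 1 -> exists t, e < F k t.
Proof.
move=> e0.
pose B (m : nat) := [set w | X w ord0 k <= m%:R /\ A (Z w)].
have mB m : measurable (B m) by exact: measurable_coord_le.
have B0 : \bigcup_m B m = Z @^-1` A.
  apply/seteqP; split => [w [m _ []] //|w h].
  exists (Num.bound `|X w ord0 k|) => //; split => //.
  apply: le_trans (ler_norm _) (ltW _); exact: archi_boundP.
have : P \o B @ \oo --> P (\bigcup_m B m).
  apply: nondecreasing_cvg_mu => //.
  - by rewrite B0; exact: measurable_cond.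
  - move=> m m' mm'; apply/subsetPset => w [h1 h2]; split => //.
    by apply: le_trans h1 _; rewrite ler_nat.
rewrite B0 PrE; last exact: measurable_cond.
move=> h.
have e1 : ((e * pA)%:E < pA%:E :> \bar R)%E by rewrite lte_fin gtr_pMl.
have /h [m _ hm] := open_ereal_gt' e1.
exists m%:R; have := hm m (leqnn m).
by rewrite /= PrE // lte_fin /Fcond ltr_pdivlMr.
Qed.

Lemma Fcond_onto k t : 0 < t < 1 -> exists s, F k s = t.
Proof.
move=> /andP[t0 t1].
have [a ha] := Fcond_lt k t0; have [b hb] := Fcond_gt k t1.
have ab : a <= b.
  by rewrite leNgt; apply/negP => /ltW /(Fcond_nondecreasing k) h; lra.
have [||c _ <-] := @IVT R (F k) a b t ab; last by exists c.
  by apply: continuous_subspaceT => x; exact: contF.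
by rewrite ge_min le_max (ltW ha) (ltW hb) /= orbT.
Qed.

(* [ukone u k] is convertible to [marg k (u ord0 k)]. *)
Definition marg (k : 'I_p) (t : R) : 'rV[R]_p := \row_j (if j == k then t else 1).

Lemma joint_orthant_marg k t (X' : T -> 'rV[R]_p) (Z' : T -> 'rV[R]_q) :
  joint X' Z' @^-1` orthant (marg k t) = [set w | F k (X' w ord0 k) <= t /\ A (Z' w)].
Proof.
rewrite joint_orthant; apply/seteqP; split => w /= [h1 h2]; split => //.
  by have := h1 k; rewrite mxE eqxx.
by move=> j; rewrite mxE; case: eqP => [->//|_]; exact: Fcond_le1.
Qed.

Lemma measurable_orthant u : measurable (joint X Z @^-1` orthant u).
Proof. by apply: rvXZ; exact: borel_rV_orthant. Qed.

(** Probability integral transform: continuity of the conditional margin makes [U_k] uniform given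
    [Z] in [A]. Both inequalities compare [F(X) <= t] with an event [X <= s], where [s] comes from
    the intermediate value theorem. *)
Lemma Dfun_marg k t : 0 <= t <= 1 -> D (marg k t) = pA * t.
Proof.
move=> /andP[t0 t1].
have mE := measurable_orthant (marg k t).
rewrite DfunE; move: mE; rewrite joint_orthant_marg; set E := [set w | _] => mE.
have FE s : Pr P [set w | X w ord0 k <= s /\ A (Z w)] = F k s * pA.
  by rewrite /Fcond divfK // gt_eqF.
apply/eqP; rewrite eq_le; apply/andP; split.
- rewrite leNgt; apply/negP => h.
  have hE1 : Pr P E <= pA.
    by apply: Pr_le => //; [exact: measurable_cond | move=> w []].
  have h' : t < Pr P E / pA by rewrite ltr_pdivlMr // mulrC.
  have h1' : Pr P E / pA <= 1 by rewrite ler_pdivrMr // mul1r.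
  set r := Pr P E / pA in h' h1'.
  (* If the conditional probability [r] exceeded [t], a level strictly between them would be
     attained at some [s]; then [F(X) <= t] forces [X <= s], whence [r <= (t + r) / 2], a
     contradiction. *)
  have [|s hs] := @Fcond_onto k ((t + r) / 2); first by apply/andP; split; lra.
  have : Pr P E <= F k s * pA.
    rewrite -FE; apply: Pr_le => //; first exact: measurable_coord_le.
    move=> w [e1 e2]; split => //; rewrite leNgt; apply/negP => /ltW.
    by move/(Fcond_nondecreasing k); lra.
  by rewrite hs -ler_pdivrMr // -/r; lra.
- move: t0; rewrite (le_eqVlt 0 t) => /orP[/eqP<-|t0].
    by rewrite mulr0; apply: fine_ge0.
  move: t1; rewrite (le_eqVlt t 1) => /orP[/eqP t1|t1].
    rewrite t1 mulr1; apply: Pr_le => //; first exact: measurable_cond.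
    by move=> w h; split => //; rewrite t1; exact: Fcond_le1.
  have [|s hs] := @Fcond_onto k t; first by rewrite t0.
  rewrite mulrC -hs -FE; apply: Pr_le => //; first exact: measurable_coord_le.
  by move=> w [e1 e2]; split => //; rewrite -hs; exact: Fcond_nondecreasing.
Qed.

Definition le_rV (u v : 'rV[R]_p) := forall k, u ord0 k <= v ord0 k.

Lemma orthant_subset u v : le_rV u v -> orthant u `<=` orthant v.
Proof. by move=> uv x [h1 h2]; split => // k; exact: le_trans (h1 k) (uv k). Qed.

Lemma Dfun_le u v : le_rV u v -> D u <= D v.
Proof.
move=> uv; rewrite !DfunE; apply: Pr_le; try exact: measurable_orthant.
by move=> w; exact: orthant_subset.
Qed.

Lemma pA_le1 : pA <= 1.
Proof.
by rewrite -lee_fin -PrE ?probability_le1 //; exact: measurable_cond.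
Qed.

(** The difference of two nested orthants is covered by one strip per coordinate, and the uniform
    margins give the probability of each strip. *)
Lemma Dfun_lipschitz u v : unit_cube u -> unit_cube v -> le_rV u v ->
  D v - D u <= pA * \sum_k (v ord0 k - u ord0 k).
Proof.
move=> cu cv uv; have mO := measurable_orthant.
rewrite !DfunE -Pr_setD //; last by move=> w; exact: orthant_subset.
pose G k := joint X Z @^-1` orthant (marg k (v ord0 k)) `\`
            joint X Z @^-1` orthant (marg k (u ord0 k)).
have mG k : measurable (G k) by exact: measurableD.
have hG k : (P (G k) <= (pA * (v ord0 k - u ord0 k))%:E)%E.
  rewrite PrE // lee_fin Pr_setD // -?DfunE ?Dfun_marg // ?mulrBr //.
  move=> w; apply: orthant_subset => j; rewrite !mxE; case: ifP => _ //; exact: uv.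
rewrite -lee_fin mulr_sumr -PrE; last exact: measurableD.
apply: le_trans (measure_bigcup_fin_le mG hG).
apply: le_measure; rewrite ?inE; [exact: measurableD | |].
  by apply: fin_bigcup_measurable => //; exact: finite_finset.
rewrite !joint_orthant => w [[h1 h2] h3].
have [k hk] : exists k, ~ (F k (X w ord0 k) <= u ord0 k).
  by apply/existsNP => h; apply: h3.
exists k => //; rewrite /G !joint_orthant_marg; split; first by split.
by case.
Qed.

End Margins.

(** * Increments of the empirical process as centred binomials *)

Section Increments.
Context (d : measure_display) (T : measurableType d) (R : realType)
  (P : probability T R) (p q : nat)
  (X : T -> 'rV[R]_p) (Z : T -> 'rV[R]_q)
  (Xs : nat -> T -> 'rV[R]_p) (Zs : nat -> T -> 'rV[R]_q) (A : set 'rV[R]_q).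
Hypothesis iid : iid_copies P X Z Xs Zs.
Hypothesis borelA : borel_rV A.
Hypothesis pA0 : 0 < pA P Z A.
Hypothesis contF : forall k, continuous (Fcond P X Z A k).

Local Notation F := (Fcond P X Z A).
Local Notation D := (Dfun P X Z A).
Local Notation pA := (pA P Z A).
Local Notation orthant := (orthant P X Z A).
Local Notation alpha := (DDn P X Z Xs Zs A).

Let rvXZ : random_vector (joint X Z). Proof. by case: iid. Qed.

Lemma mem_orthant i (u : 'rV[R]_p) w :
  [forall k, UAi P X Z Xs A i k w <= u ord0 k] && (Zs i w \in A) =
  (w \in joint (Xs i) (Zs i) @^-1` orthant u).
Proof.
rewrite joint_orthant; apply/andP/idP => [[/forallP h1 /set_mem h2]|/set_mem[h1 h2]].
  exact/mem_set.
by split; [exact/forallP | exact/mem_set].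
Qed.

Section Pair.
Variables u v : 'rV[R]_p.
Hypothesis uv : le_rV u v.

Let E (i : nat) : set T := joint (Xs i) (Zs i) @^-1` (orthant v `\` orthant u).

Let borelE : borel_rV (orthant v `\` orthant u).
Proof. by apply: borel_rV_setD; exact: borel_rV_orthant. Qed.

Lemma DDn_increment n w : (0 < n)%N ->
  alpha n v w - alpha n u w =
  (Num.sqrt n%:R)^-1 * (\sum_(i < n) (w \in E i)%:R - n%:R * (D v - D u)).
Proof.
move=> n0; rewrite /DDn /Dn.
have -> : \sum_(i < n) (w \in E i)%:R =
    \sum_(i < n) ([forall k, UAi P X Z Xs A i k w <= v ord0 k] && (Zs i w \in A))%:R
  - \sum_(i < n) ([forall k, UAi P X Z Xs A i k w <= u ord0 k] && (Zs i w \in A))%:R :> R.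
  rewrite -sumrB; apply: eq_bigr => i _; rewrite !mem_orthant.
  have [hu|hu] := boolP (w \in joint (Xs i) (Zs i) @^-1` orthant u).
    have hv : w \in joint (Xs i) (Zs i) @^-1` orthant v.
      by apply/mem_set; apply: (orthant_subset uv); exact: set_mem hu.
    rewrite hv subrr; case: (boolP (w \in E i)) => // /set_mem[_] /=.
    by move/set_mem: hu.
  rewrite subr0; congr (_%:R); congr nat_of_bool; apply/idP/idP => /set_mem.
    by case=> h _; exact/mem_set.
  by move=> h; apply/mem_set; split => // h'; move/negP: hu; apply; exact/mem_set.
have s0 : 0 < Num.sqrt n%:R :> R by rewrite sqrtr_gt0 ltr0n.
have sn : n%:R = Num.sqrt n%:R ^+ 2 :> R by rewrite sqr_sqrtr.
move: s0 sn; move: (Num.sqrt _) => s s0 ->.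
by field; rewrite gt_eqF.
Qed.

Let prob_E i : Pr P (E i) = D v - D u.
Proof.
have mO := measurable_orthant rvXZ borelA contF.
case: iid => _ [_ [eqd _]].
rewrite /Pr eqd // !DfunE -Pr_setD //.
by move=> w; exact: orthant_subset.
Qed.

Let measurable_E i : measurable (E i).
Proof. by case: iid => _ [rv _]; exact: rv. Qed.

Lemma prob_pattern n (c : {ffun 'I_n -> bool}) :
  P [set w | forall i : 'I_n, (w \in E i) = c i] =
  (\prod_(i < n) (if c i then D v - D u else 1 - (D v - D u)))%:E.
Proof.
(* Independence is stated for families indexed by [nat], so the pattern is extended by [false]
   beyond [n]. *)
pose c' (i : nat) := odflt false (omap c (insub i)).
have c'E (i : 'I_n) : c' i = c i by rewrite /c' valK.
pose B (i : nat) := if c' i then orthant v `\` orthant u else ~` (orthant v `\` orthant u).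
have bB i : borel_rV (B i).
  by rewrite /B; case: ifP => _ //; exact: borel_rV_setC.
case: iid => _ [rv [_ ind]].
have mB i : measurable (joint (Xs i) (Zs i) @^-1` B i) by exact: rv.
have -> : [set w | forall i : 'I_n, (w \in E i) = c i] =
   [set w | forall i, i \in iota 0 n -> B i (joint (Xs i) (Zs i) w)].
  apply/seteqP; split => w /= h.
    move=> i; rewrite mem_iota add0n /= => ni.
    have := h (Ordinal ni); rewrite -c'E /B /=; case: (c' i) => [/set_mem//|].
    by move=> h1 h2; move: h1; rewrite mem_set.
  move=> i; rewrite -c'E; have := h i; rewrite mem_iota ltn_ord /B => /(_ isT).
  case: (c' i) => h1; first exact/mem_set.
  by apply/negP => /set_mem.
rewrite PrE; last first.
  rewrite (_ : [set w | _] = \bigcap_(i in [set` iota 0 n]) (joint (Xs i) (Zs i) @^-1` B i)).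
    by apply: fin_bigcap_measurable => //; exact: finite_seq.
  by apply/seteqP; split.
congr EFin; rewrite ind ?iota_uniq //.
rewrite -[iota 0 n](_ : index_iota 0 n = _) ?big_mkord; last by rewrite /index_iota subn0.
apply: eq_bigr => i _.
rewrite /B -c'E; case: (c' i) => //.
  exact: prob_E.
rewrite -preimage_setC -(prob_E i); apply: EFin_inj.
rewrite -PrE; last by apply: measurableC; exact: measurable_E.
by rewrite probability_setC ?EFinB -?PrE //; exact: measurable_E.
Qed.

(** Chernoff with parameters [lam] and [- lam]; the restriction on [x] says exactly that
    [lam <= 1/2]. *)
Lemma DDn_increment_tail n (x s : R) : (0 < n)%N -> 0 < s -> 0 < x ->
  D v - D u <= s -> x <= 2 * s * Num.sqrt n%:R ->
  exists B : set T, [/\ measurable B,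
    [set w | x < `|alpha n v w - alpha n u w|] `<=` B &
    (P B <= (2 * expR (- (x ^+ 2 / (8 * s))))%:E)%E].
Proof.
move=> n0 s0 x0 hs hx.
set b := D v - D u.
have b0 : 0 <= b by rewrite subr_ge0; exact: (Dfun_le rvXZ).
have b1 : b <= 1.
  by rewrite /b -(prob_E 0) -lee_fin -PrE // probability_le1.
have b01 : 0 <= b <= 1 by rewrite b0.
pose r : R := Num.sqrt n%:R.
have r0 : 0 < r by rewrite sqrtr_gt0 ltr0n.
have rn : n%:R = r ^+ 2 :> R by rewrite sqr_sqrtr.
(* With this choice [t = x^2 / (4 s)], and the quadratic term is at most [x^2 / (8 s)] because the
   success probability is at most [s]; half of the gain survives. *)
pose lam := x / (4 * s * r).
have sr : 0 < 4 * s * r by rewrite !mulr_gt0.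
have lam0 : 0 < lam by rewrite divr_gt0.
have lam1 : lam <= 2^-1 by rewrite ler_pdivrMr // -/r in hx *; lra.
have lamN : - lam <= 2^-1 by lra.
pose t := lam * r * x.
have [m1 p1] := @chernoff _ _ _ P n (fun i : 'I_n => E i) b (fun i => measurable_E i) b01 (@prob_pattern n) lam t lam1.
have [m2 p2] := @chernoff _ _ _ P n (fun i : 'I_n => E i) b (fun i => measurable_E i) b01 (@prob_pattern n) (- lam) t lamN.
have expo : expR (- t + 2 * n%:R * b * lam ^+ 2) <= expR (- (x ^+ 2 / (8 * s))).
  rewrite ler_expR.
  have e1 : t = x ^+ 2 / (4 * s) by rewrite /t /lam; field; rewrite !gt_eqF.
  have e2 : 2 * n%:R * b * lam ^+ 2 = b * (x ^+ 2 / (8 * s ^+ 2)).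
    by rewrite /lam rn; field; rewrite !gt_eqF.
  have e3 : b * (x ^+ 2 / (8 * s ^+ 2)) <= s * (x ^+ 2 / (8 * s ^+ 2)).
    by rewrite ler_wpM2r // divr_ge0 ?mulr_ge0 ?exprn_ge0 // ltW.
  have e4 : s * (x ^+ 2 / (8 * s ^+ 2)) = x ^+ 2 / (8 * s).
    by field; rewrite gt_eqF.
  have e5 : x ^+ 2 / (4 * s) = 2 * (x ^+ 2 / (8 * s)) by field; rewrite gt_eqF.
  by lra.
eexists; split; [exact: measurableU m1 m2 | |].
  move=> w /=; rewrite DDn_increment // -/r -/b.
  set S := (_ - _); rewrite /t.
  have SE : S = r * (r^-1 * S) by rewrite mulrA divff ?mul1r // gt_eqF.
  rewrite {2 3}SE; move: (r^-1 * S) => z.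
  have lr : 0 < lam * r by rewrite mulr_gt0.
  have [z0|z0] := lerP 0 z => hz; [left|right].
    by rewrite mulrA ler_pM2l //; rewrite ger0_norm // in hz; exact: ltW.
  by rewrite mulNr -mulrN -mulrN mulrA ler_pM2l //; rewrite ltr0_norm // in hz; exact: ltW.
rewrite sqrrN in p2.
apply: le_trans (measureU2 _ m1 m2) _.
rewrite mulr2n mulrDl mul1r EFinD; apply: leeD.
  by apply: le_trans p1 _; rewrite lee_fin.
by apply: le_trans p2 _; rewrite lee_fin.
Qed.

End Pair.
End Increments.

(** * Dyadic chaining *)

Section Grid.
Variables (R : realType) (p : nat).

Definition grid_point (j : nat) (g : 'I_p -> nat) : 'rV[R]_p :=
  \row_k ((g k)%:R / 2 ^+ j).

(** All coordinates may move at once, so one relation covers both the passage from a level to the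
    next finer one and the neighbours within a level. *)
Definition grid_step (j : nat) (g g' : 'I_p -> nat) : Prop :=
  forall k, (g k <= g' k <= (g k).+1)%N /\ (g' k <= 2 ^ j)%N.

Definition grid_bound (a : 'rV[R]_p -> R) (K : R) (J : nat) : Prop :=
  forall j, (j <= J)%N -> forall g g', grid_step j g g' ->
  `|a (grid_point j g') - a (grid_point j g)| <= K * (3 / 4) ^+ j.

Definition grid_floor (j : nat) (u : 'rV[R]_p) (k : 'I_p) : nat :=
  Num.truncn (2 ^+ j * u ord0 k).

Lemma two_pow_gt0 (j : nat) : 0 < 2 ^+ j :> R.
Proof. by rewrite exprn_gt0. Qed.

Lemma grid_floorP j u k : unit_cube u ->
  (grid_floor j u k)%:R <= 2 ^+ j * u ord0 k < (grid_floor j u k).+1%:R.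
Proof.
move=> cu; have /andP[u0 u1] := cu k.
by apply: truncn_itv; rewrite mulr_ge0 // exprn_ge0.
Qed.

Lemma grid_floor_le j u k : unit_cube u -> (grid_floor j u k <= 2 ^ j)%N.
Proof.
move=> cu; have /andP[u0 u1] := cu k.
have /andP[h _] := grid_floorP j k cu.
rewrite -(ler_nat R) natrX; apply: le_trans h _.
by rewrite ler_piMr // exprn_ge0.
Qed.

Lemma grid_pointS j g : grid_point j g = grid_point j.+1 (fun k => (2 * g k)%N).
Proof.
apply/rowP => k; rewrite !mxE exprS natrM.
by have := two_pow_gt0 j; move: (2 ^+ j) => z z0; field; rewrite gt_eqF.
Qed.

(** The integer part of [2 y] is twice that of [y], or one more: this is the link between
    consecutive levels of a chain. *)
Lemma grid_floorS_step j u : unit_cube u ->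
  grid_step j.+1 (fun k => (2 * grid_floor j u k)%N) (grid_floor j.+1 u).
Proof.
move=> cu k; split; last exact: grid_floor_le.
have /andP[h1 h2] := grid_floorP j k cu.
have := grid_floorP j.+1 k cu; rewrite exprS => /andP[h3 h4].
have a1 : ((2 * grid_floor j u k)%N%:R : R) < (grid_floor j.+1 u k).+1%:R.
  by rewrite natrM; lra.
have a2 : ((grid_floor j.+1 u k)%:R : R) < (2 * (grid_floor j u k).+1)%N%:R.
  by rewrite natrM; lra.
by move: a1 a2; rewrite !ltr_nat; lia.
Qed.

(** Nearby points need not have comparable grid floors, but these differ by at most one in each
    coordinate, so their minimum is one step below both. *)
Lemma grid_floor_min_step j u v : unit_cube u -> unit_cube v ->
  (forall k, `|u ord0 k - v ord0 k| <= 2^-1 ^+ j) ->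
  grid_step j (fun k => minn (grid_floor j u k) (grid_floor j v k)) (grid_floor j u).
Proof.
move=> cu cv uv k; split; last exact: grid_floor_le.
have /andP[h1 h2] := grid_floorP j k cu.
have /andP[h3 h4] := grid_floorP j k cv.
have h5 : 2 ^+ j * u ord0 k <= 2 ^+ j * v ord0 k + 1.
  have := uv k; rewrite exprVn ler_norml => /andP[_ h].
  have : 2 ^+ j * (u ord0 k - v ord0 k) <= 1 :> R.
    by rewrite mulrC -ler_pdivlMr ?two_pow_gt0 // div1r.
  by rewrite mulrBr; lra.
have a1 : ((grid_floor j u k)%:R : R) < (grid_floor j v k).+2%:R.
  by rewrite -[(_.+2)%:R]natr1; lra.
by move: a1; rewrite !ltr_nat; lia.
Qed.

(** The cap at [2 ^ j] keeps the upper corner inside the cube when a coordinate equals 1. *)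
Lemma grid_floor_upper_step j u : unit_cube u ->
  grid_step j (grid_floor j u) (fun k => minn (grid_floor j u k).+1 (2 ^ j)).
Proof. by move=> cu k; have := grid_floor_le j k cu; lia. Qed.

Lemma grid_floor_point_le j u : unit_cube u ->
  le_rV (grid_point j (grid_floor j u)) u.
Proof.
move=> cu k; rewrite mxE ler_pdivrMr ?two_pow_gt0 // mulrC.
by have /andP[] := grid_floorP j k cu.
Qed.

Lemma grid_upper_point_ge j u : unit_cube u ->
  le_rV u (grid_point j (fun k => minn (grid_floor j u k).+1 (2 ^ j))).
Proof.
move=> cu k; rewrite mxE ler_pdivlMr ?two_pow_gt0 // mulrC.
have /andP[_ h] := grid_floorP j k cu; have /andP[_ u1] := cu k.
rewrite /minn; case: ifP => _; first exact: ltW.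
by rewrite natrX ler_piMr // exprn_ge0.
Qed.

Lemma grid_point_cube j g : (forall k, (g k <= 2 ^ j)%N) -> unit_cube (grid_point j g).
Proof.
move=> hg k; rewrite mxE divr_ge0 ?exprn_ge0 //= ler_pdivrMr ?two_pow_gt0 //.
by rewrite mul1r -natrX ler_nat.
Qed.

Lemma grid_step_le j g g' : grid_step j g g' -> le_rV (grid_point j g) (grid_point j g').
Proof.
move=> h k; have [/andP[h1 _] _] := h k.
by rewrite !mxE ler_wpM2r ?ler_nat // invr_ge0 exprn_ge0.
Qed.

Lemma grid_step_diff j g g' : grid_step j g g' ->
  \sum_k (grid_point j g' ord0 k - grid_point j g ord0 k) <= p%:R / 2 ^+ j.
Proof.
move=> h.
apply: (@le_trans _ _ (\sum_(k < p) (2 ^+ j)^-1)).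
  apply: ler_sum => k _; have [/andP[_ h1] _] := h k.
  rewrite !mxE -mulrBl ler_piMl ?invr_ge0 ?exprn_ge0 //.
  by move: h1; rewrite -(ler_nat R) -natr1; lra.
by rewrite sumr_const card_ord mulr_natl.
Qed.

Section Chaining.
Variables (a : 'rV[R]_p -> R) (K tau : R) (J : nat).
Hypothesis K0 : 0 <= K.
Hypothesis gridK : grid_bound a K J.
Hypothesis interp : forall u g g', unit_cube u -> grid_step J g g' ->
  le_rV (grid_point J g) u -> le_rV u (grid_point J g') ->
  `|a u - a (grid_point J g)| <= `|a (grid_point J g') - a (grid_point J g)| + tau.

Let proj j u := grid_point j (grid_floor j u).

(** Downward induction from the finest level, where [interp] controls the inside of a cell. The
    constant 4 reproduces itself because [4 * (3/4) + 3/4 <= 4]. *)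
Lemma chaining_proj j u : unit_cube u -> (j <= J)%N ->
  `|a u - a (proj j u)| <= 4 * K * (3 / 4) ^+ j + tau.
Proof.
move=> cu jJ; rewrite -(subKn jJ); elim: (J - j)%N (leq_subr j J) => {j jJ} [|m IH] mJ.
  rewrite subn0.
  have st := grid_floor_upper_step J cu.
  apply: le_trans (interp cu st (grid_floor_point_le J cu) (grid_upper_point_ge J cu)) _.
  have := gridK (leqnn J) st.
  have : 0 <= K * (3 / 4) ^+ J by rewrite mulr_ge0 // exprn_ge0.
  rewrite -mulrA; lra.
set j := (J - m.+1)%N.
have jE : (J - m)%N = j.+1 by rewrite /j; lia.
have := IH (ltnW mJ); rewrite jE => {}IH.
have hj : (j.+1 <= J)%N by rewrite /j; lia.
have st := gridK hj (grid_floorS_step j cu).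
rewrite -grid_pointS in st.
have tri := ler_distD (a (proj j.+1 u)) (a u) (a (proj j u)).
rewrite /proj in tri IH *.
have q0 : 0 <= K * (3 / 4) ^+ j by rewrite mulr_ge0 // exprn_ge0.
have e : K * (3 / 4) ^+ j.+1 = 3 / 4 * (K * (3 / 4) ^+ j) by rewrite exprS mulrCA.
rewrite e in st; rewrite -mulrA e in IH; rewrite -mulrA.
by move: q0 IH st tri; move: (K * _) => z; lra.
Qed.

(** The path runs from [u] to its floor, to the common minimum, to the floor of [v], to [v]: two
    chains of weight 4 and two single steps make 10, and each chain ends with one [tau]. *)
Lemma chaining_modulus j u v : unit_cube u -> unit_cube v -> (j <= J)%N ->
  (forall k, `|u ord0 k - v ord0 k| <= 2^-1 ^+ j) ->
  `|a u - a v| <= 10 * K * (3 / 4) ^+ j + 2 * tau.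
Proof.
move=> cu cv jJ uv.
have vu k : `|v ord0 k - u ord0 k| <= 2^-1 ^+ j by rewrite distrC.
have h1 := chaining_proj cu jJ; have h2 := chaining_proj cv jJ.
have h3 := gridK jJ (grid_floor_min_step cu cv uv).
have := gridK jJ (grid_floor_min_step cv cu vu).
rewrite (_ : (fun k => minn (grid_floor j v k) (grid_floor j u k)) =
  (fun k => minn (grid_floor j u k) (grid_floor j v k))); last first.
  by apply/funext => k; rewrite minnC.
move: h1 h2 h3; rewrite /proj.
move: (a (grid_point j _)) (a (grid_point j (grid_floor j v))) (a (grid_point j (fun k => _))).
move: (a u) (a v) => x y z1 z2 z3.
rewrite -!mulrA; move: (K * _) => z.
rewrite !ler_norml => /andP[? ?] /andP[? ?] /andP[? ?] /andP[? ?].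
by apply/andP; split; lra.
Qed.

End Chaining.
End Grid.

Section PowerGrowth.
Variable R : realType.

(** Bernoulli's inequality and the Archimedean property. *)
Lemma pow_eventually_ge (h x : R) : 0 < h ->
  exists m0, forall m, (m0 <= m)%N -> x <= (1 + h) ^+ m.
Proof.
move=> h0.
have bern m : 1 + m%:R * h <= (1 + h) ^+ m.
  elim: m => [|m IH]; first by rewrite mul0r addr0.
  rewrite exprS; apply: le_trans (_ : (1 + h) * (1 + m%:R * h) <= _).
    rewrite -natr1; have : 0 <= m%:R * h ^+ 2 by rewrite mulr_ge0 // exprn_ge0 // ltW.
    by rewrite expr2; lra.
  by rewrite ler_wpM2l //; lra.
exists (Num.bound (`|x| / h)) => m hm.
apply: le_trans (bern m); apply: le_trans (ler_norm x) _.
have := archi_boundP (divr_ge0 (normr_ge0 x) (ltW h0)).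
rewrite ltr_pdivrMr // => h1.
have : (Num.bound (`|x| / h))%:R * h <= m%:R * h by rewrite ler_pM2r // ler_nat.
lra.
Qed.
End PowerGrowth.

(** * The event of high probability on which the process is regular *)

Section GoodEvent.
Context (d : measure_display) (T : measurableType d) (R : realType)
  (P : probability T R) (p q : nat)
  (X : T -> 'rV[R]_p) (Z : T -> 'rV[R]_q)
  (Xs : nat -> T -> 'rV[R]_p) (Zs : nat -> T -> 'rV[R]_q) (A : set 'rV[R]_q).
Hypothesis iid : iid_copies P X Z Xs Zs.
Hypothesis borelA : borel_rV A.
Hypothesis pA0 : 0 < pA P Z A.
Hypothesis contF : forall k, continuous (Fcond P X Z A k).

Local Notation D := (Dfun P X Z A).
Local Notation pA := (pA P Z A).
Local Notation orthant := (orthant P X Z A).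
Local Notation alpha := (DDn P X Z Xs Zs A).
Local Notation c := (p.+1%:R : R).

Let rvXZ : random_vector (joint X Z). Proof. by case: iid. Qed.

Lemma Dn_le n u v w : le_rV u v -> Dn P X Z Xs Zs A n u w <= Dn P X Z Xs Zs A n v w.
Proof.
move=> uv; rewrite /Dn ler_wpM2l ?invr_ge0 //; apply: ler_sum => i _.
rewrite ler_nat; case: (boolP (_ && _)) => // /andP[/forallP h1 ->].
rewrite andbT (_ : [forall k, _]) //; apply/forallP => k.
exact: le_trans (h1 k) (uv k).
Qed.

(** [Dn] and [D] are both monotone, so the oscillation inside a cell is at most the increment across
    it plus the drift of [D]; this closes the chain at the finest mesh. *)
Lemma DDn_interp n u v v' w : le_rV u v -> le_rV v v' ->
  `|alpha n v w - alpha n u w| <=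
  `|alpha n v' w - alpha n u w| + Num.sqrt n%:R * (D v' - D u).
Proof.
move=> uv vv'.
have h1 := @Dn_le n u v w uv; have h2 := @Dn_le n v v' w vv'.
have h3 := Dfun_le rvXZ borelA contF uv; have h4 := Dfun_le rvXZ borelA contF vv'.
rewrite /DDn -!mulrBr !normrM (ger0_norm (sqrtr_ge0 _)) -mulrDr.
apply: ler_wpM2l; first exact: sqrtr_ge0.
move: h1 h2 h3 h4.
move: (Dn _ _ _ _ _ _ _ u w) (Dn _ _ _ _ _ _ _ v w) (Dn _ _ _ _ _ _ _ v' w).
move: (D u) (D v) (D v') => x1 x2 x3 y1 y2 y3 h1 h2 h3 h4.
have := ler_norm (y3 - x3 - (y1 - x1)); have := ler_norm (- (y3 - x3 - (y1 - x1))).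
rewrite normrN => h5 h6.
by rewrite ler_norml; apply/andP; split; lra.
Qed.

(** The constant is [p + 1] rather than [p] so that the variance bound fed to Chernoff is positive
    in every dimension. *)
Lemma grid_step_Dfun j g g' : grid_step j g g' ->
  D (grid_point R j g') - D (grid_point R j g) <= c / 2 ^+ j.
Proof.
move=> st.
have cg' : unit_cube (grid_point R j g') by apply: grid_point_cube => k; case: (st k).
have cg : unit_cube (grid_point R j g).
  by apply: grid_point_cube => k; case: (st k) => /andP[+ _]; exact: leq_trans.
apply: le_trans (Dfun_lipschitz rvXZ borelA pA0 contF cg cg' (grid_step_le R st)) _.
have h := grid_step_diff R st.
have h0 : 0 <= \sum_k (grid_point R j g' ord0 k - grid_point R j g ord0 k).
  by apply: sumr_ge0 => k _; rewrite subr_ge0; exact: grid_step_le.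
apply: (@le_trans _ _ (\sum_k (grid_point R j g' ord0 k - grid_point R j g ord0 k))).
  by rewrite ler_piMl //; exact: (pA_le1 P rvXZ borelA).
apply: le_trans h _; rewrite ler_wpM2r ?invr_ge0 ?exprn_ge0 // ler_nat //.
Qed.

(** Union bound over levels and pairs. At level [j] the variance bound is [c / 2^j], so the
    threshold [K (3/4)^j] gives the exponent [K^2 (9/8)^j / (8 c)]; the range condition of the tail
    bound becomes [K (3/2)^j <= 2 c sqrt n], which is strongest at [j = J]. *)
Lemma grid_event n J (K : R) : (0 < n)%N -> 0 < K ->
  K * (3 / 2) ^+ J <= 2 * c * Num.sqrt n%:R ->
  exists E : set T, [/\ measurable E,
    (forall w, ~ E w -> grid_bound (fun u => alpha n u w) K J) &
    (P E <= (\sum_(j < J.+1) 2 * (((2 ^ j).+1 ^ p) ^ 2)%:R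
       * expR (- (K ^+ 2 * (9 / 8) ^+ j / (8 * c))))%:E)%E].
Proof.
move=> n0 K0 hK.
have c0 : 0 < c by rewrite ltr0n.
pose G (j : 'I_J.+1) := ({ffun 'I_p -> 'I_(2 ^ j).+1} * {ffun 'I_p -> 'I_(2 ^ j).+1})%type.
pose pt j (g : {ffun 'I_p -> 'I_(2 ^ j).+1}) := fun k => g k : nat.
pose e (j : nat) : R := 2 * expR (- (K ^+ 2 * (9 / 8) ^+ j / (8 * c))).
have e0 j : 0 <= e j by rewrite mulr_ge0 // expR_ge0.
have step1 (j : 'I_J.+1) (g : G j) : exists B : set T, [/\ measurable B,
   grid_step j (pt j g.1) (pt j g.2) ->
   [set w | K * (3 / 4) ^+ j < `|alpha n (grid_point R j (pt j g.2)) w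
       - alpha n (grid_point R j (pt j g.1)) w|] `<=` B &
   (P B <= (e j)%:E)%E].
  (* Pairs that are not grid steps receive the empty event, so that the union may run over all
     pairs. *)
  have [st|nst] := pselect (grid_step j (pt j g.1) (pt j g.2)); last first.
    by exists set0; split => //; rewrite measure0 lee_fin.
  have s0 : 0 < c / 2 ^+ j by rewrite divr_gt0 // exprn_gt0.
  have x0 : 0 < K * (3 / 4) ^+ j by rewrite mulr_gt0 // exprn_gt0.
  have hx : K * (3 / 4) ^+ j <= 2 * (c / 2 ^+ j) * Num.sqrt n%:R.
    have h1 : K * (3 / 2) ^+ j <= 2 * c * Num.sqrt n%:R.
      apply: le_trans hK; rewrite ler_pM2l // ler_weXn2l //; first by lra.
      by rewrite -ltnS.
    have -> : K * (3 / 4) ^+ j = K * (3 / 2) ^+ j / 2 ^+ j.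
      by rewrite -mulrA -exprVn -exprMn; congr (_ * _ ^+ _); lra.
    rewrite mulrA [_ / _ * Num.sqrt _]mulrAC ler_wpM2r // invr_ge0 exprn_ge0 //.
  have [B [mB sB pB]] := DDn_increment_tail iid borelA contF (grid_step_le R st)
     n0 s0 x0 (grid_step_Dfun st) hx.
  exists B; split => //.
  rewrite /e; apply: le_trans pB _; rewrite lee_fin ler_wpM2l // ler_expR lerN2.
  rewrite le_eqVlt; apply/orP; left; apply/eqP.
  have -> : (9 / 8 : R) ^+ j = ((3 / 4) ^+ j) ^+ 2 * 2 ^+ j.
    by rewrite -exprM mulnC exprM -exprMn; congr (_ ^+ _); lra.
  have := two_pow_gt0 R j; move: (2 ^+ j) ((3 / 4) ^+ j) => z y z0.
  by field; rewrite !gt_eqF.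
have step2 (j : 'I_J.+1) : exists B : set T, [/\ measurable B,
   (forall w, ~ B w -> forall g g' : 'I_p -> nat, grid_step j g g' ->
   `|alpha n (grid_point R j g') w - alpha n (grid_point R j g) w| <= K * (3 / 4) ^+ j) &
   (P B <= ((((2 ^ j).+1 ^ p) ^ 2)%:R * e j)%:E)%E].
  have [f hf] := choice (step1 j).
  exists (\bigcup_g f g); split.
  - apply: fin_bigcup_measurable => // [|g _]; first exact: finite_finset.
    by case: (hf g).
  - move=> w nB g g' st; rewrite leNgt; apply/negP => hlt; apply: nB.
    have bg k : (g k < (2 ^ j).+1)%N.
      by have [/andP[h1 _] h2] := st k; rewrite ltnS; exact: leq_trans h2.
    have bg' k : (g' k < (2 ^ j).+1)%N by have [_ h2] := st k; rewrite ltnS.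
    pose gg : G j := ([ffun k => Ordinal (bg k)], [ffun k => Ordinal (bg' k)]).
    have eg : pt j gg.1 = g by apply/funext => k; rewrite /pt ffunE.
    have eg' : pt j gg.2 = g' by apply/funext => k; rewrite /pt ffunE.
    exists gg => //; have [_ + _] := hf gg; rewrite eg eg' => /(_ st); exact.
  - apply: le_trans (measure_bigcup_fin_le (b := fun=> e j) _ _) _.
    + by move=> g; case: (hf g).
    + by move=> g; case: (hf g).
    + by rewrite lee_fin sumr_const card_prod !card_ffun !card_ord mulnn mulr_natl.
have [f hf] := choice step2.
exists (\bigcup_j f j); split.
- apply: fin_bigcup_measurable; first exact: finite_finset.
  by move=> j _; case: (hf j).
- move=> w nE j jJ g g' st.
  have jJ' : (j < J.+1)%N by [].
  have [_ h _] := hf (Ordinal jJ'); apply: h => // fw.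
  by apply: nE; exists (Ordinal jJ').
- apply: le_trans (measure_bigcup_fin_le (b := fun j : 'I_J.+1 => (((2 ^ j).+1 ^ p) ^ 2)%:R * e j) _ _) _.
  + by move=> j; case: (hf j).
  + by move=> j; case: (hf j).
  + rewrite lee_fin; apply: ler_sum => j _; rewrite /e.
    by rewrite mulrCA mulrA.
Qed.

(** Uniform margins have no mass at 0. This settles the face [u_k = 0], where the generalized
    inverse is minus infinity. *)
Lemma positive_event n : exists E : set T, [/\ measurable E, P E = 0%E &
  forall w, ~ E w -> forall i k, (i < n)%N -> Zs i w \in A -> 0 < UAi P X Z Xs A i k w].
Proof.
case: (iid) => _ [rv [eqd _]].
pose f (ik : 'I_n * 'I_p) := joint (Xs ik.1) (Zs ik.1) @^-1` orthant (marg ik.2 0).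
have mf ik : measurable (f ik).
  by apply: rv; exact: borel_rV_orthant.
have pf ik : (P (f ik) <= 0%:E)%E.
  rewrite eqd; last exact: borel_rV_orthant.
  rewrite PrE; last exact: measurable_orthant.
  by rewrite -DfunE (Dfun_marg rvXZ borelA pA0 contF) ?lexx ?ler01 // mulr0.
exists (\bigcup_ik f ik); split.
- by apply: fin_bigcup_measurable => //; exact: finite_finset.
- apply/eqP; rewrite eq_le measure_ge0 andbT.
  apply: le_trans (measure_bigcup_fin_le mf pf) _.
  by rewrite big1.
- move=> w nE i k ni hA; rewrite ltNge; apply/negP => h; apply: nE.
  exists (Ordinal ni, k) => //; rewrite /f joint_orthant_marg //=.
  by split => //; exact: set_mem.
Qed.

(** The order of the quantifiers matters: [K] depends on [delta] alone and so bounds the process,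
    after which [tau] and the level [j0] can be tuned to make the modulus small. *)
Lemma empirical_good (delta : R) : 0 < delta -> exists2 K : R, 0 < K &
  forall (tau : R) (j0 : nat), 0 < tau -> \forall n \near \oo, exists E : set T,
  [/\ measurable E, (P E <= delta%:E)%E & forall w, ~ E w ->
    (forall j u v, (j <= j0)%N -> unit_cube u -> unit_cube v ->
      (forall k, `|u ord0 k - v ord0 k| <= 2^-1 ^+ j) ->
      `|alpha n u w - alpha n v w| <= 10 * K * (3 / 4) ^+ j + 2 * tau) /\
    (forall i k, (i < n)%N -> Zs i w \in A -> 0 < UAi P X Z Xs A i k w)].
Proof.
move=> d0.
have c0 : 0 < c by rewrite ltr0n.
have [|K K0 hK] := @chaining_tail_small R p (8 * c) delta _ d0; first by rewrite mulr_gt0.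
exists K => // tau j0 tau0.
(* As [(1 + 5/27) * (3/2)^3 = 4], the bound on [K] yields [K (3/2)^J <= 4^m <= sqrt n] for
   [J = 3 m]. The bound [4 c / tau <= 2^m] makes the drift [sqrt n * c / 2^J] at most [tau]. *)
have [m1 hm1] := @pow_eventually_ge R (5 / 27) K ltac:(lra).
have [m2 hm2] := @pow_eventually_ge R 1 (4 * c / tau) ltac:(lra).
pose m0 := maxn (maxn m1 m2) j0.
exists (16 ^ m0)%N => // n /= hn.
have n0 : (0 < n)%N by apply: leq_trans hn; rewrite expn_gt0.
(* [2 ^ J] lies between [n^(3/4) / 8] and [n^(3/4)], while
   [(3 / 2) ^ J = (27 / 8) ^ m] is of smaller order than [4 ^ m <= sqrt n]. *)
pose m := trunc_log 16 n; pose J := (3 * m)%N.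
have /andP[b1 b2] : (16 ^ m <= n < 16 ^ m.+1)%N by apply: trunc_log_bounds.
have m0m : (m0 <= m)%N by apply: trunc_log_max.
have sq1 : 4 ^+ m <= Num.sqrt n%:R :> R.
  rewrite -(@ler_sqr _ (4 ^+ m)) ?nnegrE ?sqrtr_ge0 ?exprn_ge0 // sqr_sqrtr //.
  by rewrite -exprM mulnC exprM -natrX -natrX ler_nat.
have sq2 : Num.sqrt n%:R <= 4 * 4 ^+ m :> R.
  rewrite -(@ler_sqr _ (Num.sqrt _)) ?nnegrE ?sqrtr_ge0 ?mulr_ge0 ?exprn_ge0 // sqr_sqrtr //.
  rewrite -exprS -exprM mulnC exprM -natrX -natrX ler_nat; exact: ltnW.
have hKJ : K * (3 / 2) ^+ J <= 2 * c * Num.sqrt n%:R.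
  have h1 : K <= (1 + 5 / 27) ^+ m by apply: hm1; apply: leq_trans m0m; rewrite /m0; lia.
  rewrite /J exprM; apply: (@le_trans _ _ (4 ^+ m)).
    apply: (@le_trans _ _ ((1 + 5 / 27) ^+ m * ((3 / 2) ^+ 3) ^+ m)).
      by rewrite ler_wpM2r // !exprn_ge0.
    rewrite -exprMn lerXn2r ?nnegrE //; lra.
  apply: le_trans sq1 _; rewrite ler_peMl ?sqrtr_ge0 //.
  have : 1 <= c by rewrite ler1n.
  lra.
have [E1 [mE1 hE1 pE1]] := grid_event n0 K0 hKJ.
have [E2 [mE2 pE2 hE2]] := positive_event n.
exists (E1 `|` E2); split; first exact: measurableU.
  apply: (@le_trans _ _ (P E1 + P E2)%E); first exact: measureU2.
  rewrite pE2 adde0.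
  by apply: le_trans pE1 _; rewrite lee_fin.
move=> w /not_orP[nE1 nE2]; split; last exact: hE2.
move=> j u v jj0 cu cv uv.
have jJ : (j <= J)%N by rewrite /J; move: m0m; rewrite /m0; lia.
apply: (chaining_modulus (J := J) (ltW K0) (hE1 w nE1)) => //.
move=> x g g' cx st gx xg'.
apply: le_trans (DDn_interp n w gx xg') _; rewrite lerD2l.
apply: (@le_trans _ _ (Num.sqrt n%:R * (c / 2 ^+ J))).
  by rewrite ler_wpM2l ?sqrtr_ge0 // grid_step_Dfun.
rewrite mulrA ler_pdivrMr ?two_pow_gt0 // /J exprM.
have h2 : 4 * c / tau <= (1 + 1) ^+ m by apply: hm2; apply: leq_trans m0m; rewrite /m0; lia.
rewrite ler_pdivrMr // in h2.
have -> : ((2 ^+ 3) ^+ m : R) = (1 + 1) ^+ m * 4 ^+ m.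
  by rewrite -exprMn; congr (_ ^+ _); lra.
apply: (@le_trans _ _ (4 * 4 ^+ m * c)); first by rewrite ler_wpM2r // ltW.
rewrite (_ : 4 * 4 ^+ m * c = 4 * c * 4 ^+ m); last by rewrite mulrAC.
rewrite mulrA [tau * _]mulrC ler_wpM2r // exprn_ge0 //.
Qed.

End GoodEvent.

(** * Coordinatewise differential calculus *)

Section CoordinateCalculus.
Variables (R : realType) (p : nat) (D : 'rV[R]_p -> R) (L : R).

Definition setc (u : 'rV[R]_p) (k : 'I_p) (t : R) : 'rV[R]_p :=
  \row_j (if j == k then t else u ord0 j).

Lemma setc_cube u k t : unit_cube u -> 0 <= t <= 1 -> unit_cube (setc u k t).
Proof. by move=> cu ht j; rewrite mxE; case: ifP. Qed.

Lemma setc_id u k : setc u k (u ord0 k) = u.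
Proof. by apply/rowP => j; rewrite mxE; case: eqP => [->|]. Qed.

Lemma setc_shift u k t h : h *: ek R k + setc u k t = setc u k (h + t).
Proof.
by apply/rowP => j; rewrite !mxE; case: eqP => _; rewrite ?mulr1 // mulr0 add0r.
Qed.

Lemma Vk_setc u k t : unit_cube u -> 0 < t < 1 -> Vk k (setc u k t).
Proof.
move=> cu ht; split; last by rewrite mxE eqxx.
by apply: setc_cube => //; case/andP: ht => /ltW -> /ltW ->.
Qed.

Hypothesis lipD : forall u k (a b : R), unit_cube u -> 0 <= a <= 1 -> 0 <= b <= 1 ->
  `|D (setc u k a) - D (setc u k b)| <= L * `|a - b|.
Hypothesis derD : forall k u, Vk k u -> derivable D u (ek R k).

Let dD (k : 'I_p) (u : 'rV[R]_p) : R := 'D_(ek R k) D u.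

Lemma setc_is_derive u k (t : R) : unit_cube u -> 0 < t < 1 ->
  is_derive t 1 (fun s => D (setc u k s)) (dD k (setc u k t)).
Proof.
move=> cu ht.
have := derD (Vk_setc k cu ht); rewrite /dD /derive /derivable.
have e : (fun h : R => h^-1 *: ((D \o shift (setc u k t)) (h *: ek R k) - D (setc u k t)))
  = (fun h : R => h^-1 *: (((fun s => D (setc u k s)) \o shift t) (h *: (1 : R)) - D (setc u k t))).
  by apply/funext => h /=; rewrite setc_shift /GRing.scale /= mulr1.
by rewrite e => h; split.
Qed.

Lemma lipschitz_within_continuous (f : R -> R) (a b : R) :
  (forall x y, x \in `[a, b] -> y \in `[a, b] -> `|f x - f y| <= L * `|x - y|) ->
  {within `[a, b], continuous f}.
Proof.
move=> lip; apply/subspace_continuousP => x /= xab.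
apply/cvgrPdist_le => e e0.
have L0 : 0 < `|L| + 1 by rewrite ltr_wpDl.
rewrite near_withinE.
apply: filterS (nbhsx_ballx x (e / (`|L| + 1)) _); last by rewrite divr_gt0.
move=> y; rewrite /ball /= => xy yab.
apply: le_trans (lip _ _ xab yab) _.
apply: (@le_trans _ _ ((`|L| + 1) * `|x - y|)).
  by rewrite ler_wpM2r //; have := ler_norm L; lra.
by rewrite mulrC -ler_pdivlMr // ltW.
Qed.

(** The endpoint [b] may lie on a face of the cube: there the Lipschitz bound supplies the
    continuity up to the boundary that the mean value theorem requires, while the intermediate point
    stays interior. *)
Lemma coord_mean_value u k (a b : R) : unit_cube u -> 0 < a < 1 -> 0 <= b <= 1 ->
  exists x, [/\ 0 < x < 1, `|x - a| <= `|b - a| &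
    D (setc u k b) - D (setc u k a) = dD k (setc u k x) * (b - a)].
Proof.
move=> cu /andP[a0 a1] /andP[b0 b1].
have mvt s t : 0 <= s -> s < t -> t <= 1 -> exists x, [/\ s < x, x < t &
    D (setc u k t) - D (setc u k s) = dD k (setc u k x) * (t - s)].
  move=> s0 st t1.
  have [||x] := @MVT R (fun y => D (setc u k y)) (fun y => dD k (setc u k y)) s t st.
  - move=> x; rewrite in_itv /= => /andP[h1 h2]; apply: setc_is_derive => //.
    by apply/andP; split; lra.
  - apply: lipschitz_within_continuous => x y; rewrite !in_itv /= => /andP[? ?] /andP[? ?].
    by apply: lipD => //; apply/andP; split; lra.
  by rewrite in_itv /= => /andP[h1 h2] h3; exists x.
have [ab|ba|ab] := ltgtP a b.
- have [x [h1 h2 h3]] := mvt a b (ltW a0) ab b1.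
  exists x; split => //; first by apply/andP; split; lra.
  by rewrite !gtr0_norm ?subr_gt0 //; lra.
- have [x [h1 h2 h3]] := mvt b a b0 ba (ltW a1).
  exists x; split => //; first by apply/andP; split; lra.
    by rewrite !ltr0_norm ?subr_lt0 //; lra.
  by rewrite -opprB h3 -mulrN opprB.
- exists a; split; first by rewrite a0.
    by rewrite subrr normr0.
  by rewrite -ab !subrr mulr0.
Qed.

(** For increments smaller than the distance to both faces, the difference quotients are bounded by
    [L], and the bound passes to the limit. *)
Lemma coord_derivative_bound k u : Vk k u -> `|dD k u| <= L.
Proof.
move=> Vu; have [cu /andP[u0 u1]] := Vu.
have cv := derD Vu.
have nh : \forall h \near (0 : R)^', `|h^-1 *: ((D \o shift u) (h *: ek R k) - D u)| <= L.
  have r0 : 0 < Num.min (u ord0 k) (1 - u ord0 k) by rewrite lt_min u0 subr_gt0.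
  have n1 := nbhs_dnbhs (nbhsx_ballx (0 : R) _ r0).
  have n2 := @nbhs_dnbhs_neq R 0.
  near=> h.
  have h0 : h != 0 by near: h.
  have : ball (0 : R) (Num.min (u ord0 k) (1 - u ord0 k)) h by near: h.
  rewrite /ball /= sub0r normrN lt_min => /andP[hb1 hb2].
  have := ler_norm h; have := ler_norm (- h); rewrite normrN => h1 h2.
  rewrite /= -{1 2}(setc_id u k) setc_shift normrZ normfV mulrC ler_pdivrMr ?normr_gt0 //.
  have := @lipD u k (h + u ord0 k) (u ord0 k) cu; rewrite addrK; apply.
    by apply/andP; split; lra.
  by rewrite !ltW.
rewrite /dD /derive ler_norml; apply/andP; split.
  apply: limr_ge => //; apply: filterS nh => h; by rewrite ler_norml => /andP[].
apply: limr_le => //; apply: filterS nh => h; by rewrite ler_norml => /andP[].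
Unshelve. all: by end_near. Qed.

Hypothesis contD : forall k, {within Vk k, continuous (dD k)}.

(** Heine-Cantor on the slab [eta <= u_k <= 1 - eta] of the cube, a compact subset of [V_k]. *)
Lemma coord_derivative_unif_continuous k (eta e : R) : 0 < eta -> 0 < e ->
  exists2 r : R, 0 < r & forall u v, unit_cube u -> unit_cube v ->
    eta <= u ord0 k <= 1 - eta -> eta <= v ord0 k <= 1 - eta ->
    (forall j, `|u ord0 j - v ord0 j| < r) -> `|dD k u - dD k v| < e.
Proof.
move=> eta0 e0.
pose C : set 'rV[R]_p := [set u | unit_cube u /\ eta <= u ord0 k <= 1 - eta].
have CV u : C u -> Vk k u.
  by move=> [cu /andP[h1 h2]]; split => //; apply/andP; split; lra.
have cC : compact C.
  pose B (j : 'I_p) : set R := if j == k then `[eta, 1 - eta]%classic `&` `[0, 1]%classic else `[0, 1]%classic.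
  have -> : C = [set u | forall j, B j (u ord0 j)].
    apply/seteqP; split => u /=.
      move=> [cu h] j; rewrite /B; case: eqP => [->|_] /=; rewrite ?in_itv /=.
        by split; [exact: h | exact: cu].
      exact: cu.
    move=> h; split => [j|]; last by have := h k; rewrite /B eqxx /= !in_itv => -[].
    by have := h j; rewrite /B; case: eqP => _ /=; rewrite ?in_itv //= => -[].
  apply: rV_compact => j; rewrite /B; case: eqP => _; last exact: segment_compact.
  by apply: compact_closedI; [exact: segment_compact | exact: interval_closed].
have := cC => /compact_near_coveringP/near_covering_withinP.
move=> /(_ R (0 : R)^'+ (fun r u => forall v, C v -> (forall j, `|u ord0 j - v ord0 j| < r) ->
  `|dD k u - dD k v| < e) _) h.
have : \forall r \near (0 : R)^'+, C `<=` (fun u => forall v, C v -> (forall j, `|u ord0 j - v ord0 j| < r) ->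
  `|dD k u - dD k v| < e).
  apply: h => u Cu.
  have e2 : 0 < e / 2 by rewrite divr_gt0.
  move/subspace_continuousP: (@contD k) => /(_ u (CV u Cu)) /cvgrPdist_lt /(_ _ e2).
  rewrite near_withinE => /nbhs_ballP[s /= s0 hs].
  have s2 : 0 < s / 2 by rewrite divr_gt0.
  (* Half of the radius is spent on the centre of the neighbourhood and half on the distance between
     the two points compared. *)
  exists (ball u (s / 2), [set r | r < s / 2]) => /=.
    split; first exact: nbhsx_ballx.
    exact: nbhs_right_lt.
  move=> [x r] /= [[_ ux] rs] Cx v Cv xv.
  have ux' j : `|u ord0 j - x ord0 j| < s / 2 := ux ord0 j.
  have bx : ball u s x.
    split => // i j; rewrite (ord1 i); apply: lt_trans (ux' j) _; lra.
  have bv : ball u s v.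
    split => // i j; rewrite (ord1 i) /ball /=.
    have := ler_distD (x ord0 j) (u ord0 j) (v ord0 j).
    by have := ux' j; have := xv j; lra.
  have := hs x bx (CV x Cx); have := hs v bv (CV v Cv).
  rewrite [`|_ - dD k x|]distrC.
  have := ler_distD (dD k u) (dD k x) (dD k v); lra.
move=> hr; have [r [{}hr r0]] := filter_ex (filterI hr (nbhs_right_gt (0 : R))).
by exists r => // u v cu cv hu hv; apply: hr.
Qed.

End CoordinateCalculus.

(** * Empirical quantiles *)

(** Here [v] is the place where [b t + a t] crosses the level [c]. The function may jump, so
    equality at [v] can fail, but only by the oscillation [om] of [a] at scale [del]. At the ends of
    the interval only one side is available, hence the two extra hypotheses. *)
Lemma crossing_bound (R : realType) (a : R -> R) (b om del v c : R) :
  0 <= b -> 0 <= om -> 0 < del -> 0 <= v <= 1 ->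
  (forall s t, 0 <= s <= 1 -> 0 <= t <= 1 -> `|s - t| <= del -> `|a s - a t| <= om) ->
  (forall t, v < t -> t <= 1 -> c <= b * t + a t) -> (v = 1 -> c <= b + a 1) ->
  (forall t, 0 <= t -> t < v -> b * t + a t <= c) -> (v = 0 -> a 0 <= c) ->
  `|b * v + a v - c| <= om.
Proof.
move=> b0 om0 del0 /andP[v0 v1] mod up up1 lo lo0.
(* A move of length [g / (b + 1)] changes the linear part by less than the excess [g], also for
   [b = 0]. *)
have small (g : R) : 0 < g -> b * (g / (b + 1)) < g.
  move=> g0; rewrite mulrA ltr_pdivrMr; nra.
rewrite ler_norml; apply/andP; split; rewrite leNgt; apply/negP => h.
  move: v1; rewrite le_eqVlt => /orP[/eqP v1|v1].
    by have := up1 v1; rewrite v1 in h; lra.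
  pose g := - om - (b * v + a v - c); have g0 : 0 < g by rewrite /g; lra.
  pose m := Num.min del (Num.min (1 - v) (g / (b + 1))).
  have [m1 m2 m3] : [/\ m <= del, m <= 1 - v & m <= g / (b + 1)].
    by rewrite /m; split; rewrite ?ge_min ?lexx ?orbT.
  have m0 : 0 < m by rewrite /m !lt_min del0 subr_gt0 v1 divr_gt0 //; lra.
  have h1 := up (v + m) ltac:(lra) ltac:(lra).
  have : `|a (v + m) - a v| <= om.
    apply: mod; try (apply/andP; split; lra).
    by rewrite addrAC subrr add0r gtr0_norm.
  rewrite ler_norml => /andP[_ h2].
  have h3 : b * m <= b * (g / (b + 1)) by rewrite ler_wpM2l.
  have := small g g0; rewrite mulrDr in h1; rewrite /g in h3 *; lra.
move: v0; rewrite le_eqVlt => /orP[/eqP v0|v0].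
  by have := lo0 (esym v0); rewrite -v0 mulr0 in h; lra.
pose g := (b * v + a v - c) - om; have g0 : 0 < g by rewrite /g; lra.
pose m := Num.min del (Num.min v (g / (b + 1))).
have [m1 m2 m3] : [/\ m <= del, m <= v & m <= g / (b + 1)].
  by rewrite /m; split; rewrite ?ge_min ?lexx ?orbT.
have m0 : 0 < m by rewrite /m !lt_min del0 v0 divr_gt0 //; lra.
have h1 := lo (v - m) ltac:(lra) ltac:(lra).
have : `|a v - a (v - m)| <= om.
  apply: mod; try (apply/andP; split; lra).
  by rewrite opprB addrCA subrr addr0 gtr0_norm.
rewrite ler_norml => /andP[_ h2].
have h3 : b * m <= b * (g / (b + 1)) by rewrite ler_wpM2l.
have := small g g0; rewrite mulrBr in h1; rewrite /g in h3 *; lra.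
Qed.

Section Sample.
Context (d : measure_display) (T : measurableType d) (R : realType)
  (P : probability T R) (p q : nat)
  (X : T -> 'rV[R]_p) (Z : T -> 'rV[R]_q)
  (Xs : nat -> T -> 'rV[R]_p) (Zs : nat -> T -> 'rV[R]_q) (A : set 'rV[R]_q).
Hypothesis iid : iid_copies P X Z Xs Zs.
Hypothesis borelA : borel_rV A.
Hypothesis pA0 : 0 < pA P Z A.
Hypothesis contF : forall k, continuous (Fcond P X Z A k).

Local Notation D := (Dfun P X Z A).
Local Notation pA := (pA P Z A).
Local Notation alpha := (DDn P X Z Xs Zs A).
Local Notation U := (UAi P X Z Xs A).
Local Notation Dn := (Dn P X Z Xs Zs A).
Local Notation G := (Gnk P X Z Xs Zs A).

Let rvXZ : random_vector (joint X Z). Proof. by case: iid. Qed.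

Variables (n : nat) (w : T) (om del : R).
Hypothesis n0 : (0 < n)%N.
Hypothesis nA0 : (0 < nA Zs A n w)%N.
Hypothesis om0 : 0 <= om.
Hypothesis del0 : 0 < del.
Hypothesis posU : forall i k, (i < n)%N -> Zs i w \in A -> 0 < U i k w.
Hypothesis modulus : forall u v, unit_cube u -> unit_cube v ->
  (forall k, `|u ord0 k - v ord0 k| <= del) -> `|alpha n u w - alpha n v w| <= om.

Lemma Dn_marg k t : Dn n (marg k t) w =
  n%:R^-1 * \sum_(i < n) ((U i k w <= t) && (Zs i w \in A))%:R.
Proof.
rewrite /Defs.Dn; congr (_ * _); apply: eq_bigr => i _; congr (nat_of_bool (_ && _))%:R.
apply/forallP/idP => [/(_ k)|h j]; first by rewrite mxE eqxx.
by rewrite mxE; case: eqP => [->//|_]; exact: (Fcond_le1 rvXZ).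
Qed.

Lemma Dn_onevec : Dn n (onevec R p) w = n%:R^-1 * (nA Zs A n w)%:R.
Proof.
rewrite /Defs.Dn /nA natr_sum; congr (_ * _); apply: eq_bigr => i _.
rewrite (_ : [forall k, _]) //; apply/forallP => k; rewrite mxE.
exact: (Fcond_le1 rvXZ).
Qed.

Lemma marg1 k : marg k 1 = onevec R p.
Proof. by apply/rowP => j; rewrite !mxE; case: ifP. Qed.

Lemma Dn_onevec_gt0 : 0 < Dn n (onevec R p) w.
Proof. by rewrite Dn_onevec mulr_gt0 ?invr_gt0 ?ltr0n. Qed.

Lemma Gnk_Dn k t : G n k w t = Dn n (marg k t) w / Dn n (onevec R p) w.
Proof.
rewrite Dn_marg Dn_onevec /Gnk eqn0Ngt nA0 /=.
have n1 : n%:R != 0 :> R by rewrite pnatr_eq0 -lt0n.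
have n2 : (nA Zs A n w)%:R != 0 :> R by rewrite pnatr_eq0 -lt0n.
by field; rewrite n1 n2.
Qed.

Lemma Dn_marg_le0 k t : t <= 0 -> Dn n (marg k t) w = 0.
Proof.
move=> t0; rewrite Dn_marg big1 ?mulr0 // => i _.
case: (boolP (_ && _)) => // /andP[h1 h2].
by have := posU k (ltn_ord i) h2; rewrite ltNge (le_trans h1 t0).
Qed.

Lemma alpha_marg k t : 0 <= t <= 1 ->
  alpha n (marg k t) w = Num.sqrt n%:R * Dn n (marg k t) w - Num.sqrt n%:R * pA * t.
Proof. by move=> ht; rewrite /DDn (Dfun_marg rvXZ borelA pA0 contF k ht); ring. Qed.

Lemma alpha_marg0 k : alpha n (marg k 0) w = 0.
Proof. by rewrite alpha_marg ?lexx ?ler01 // Dn_marg_le0 // !mulr0 subrr. Qed.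

(** Real-valued version of the generalized inverse. At [u_k = 0] the latter is minus infinity and is
    replaced by 0, which selects the same sample points since all relevant [U_{i,k}] are
    positive. *)
Definition sample_quantile (u : 'rV[R]_p) : 'rV[R]_p :=
  \row_k (if u ord0 k <= 0 then 0 else inf [set t | u ord0 k <= G n k w t]).

Local Notation Q := sample_quantile.

Lemma Gnk_nondecreasing k s t : s <= t -> G n k w s <= G n k w t.
Proof.
move=> st; rewrite !Gnk_Dn ler_wpM2r ?invr_ge0 ?(ltW Dn_onevec_gt0) //.
by apply: Dn_le => j; rewrite !mxE; case: ifP.
Qed.

Section Coordinate.
Variables (u : 'rV[R]_p) (k : 'I_p).
Hypothesis u1 : u ord0 k <= 1.
Hypothesis u0 : 0 < u ord0 k.

Let S := [set t | u ord0 k <= G n k w t].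

Let S1 : S 1.
Proof. by rewrite /S /= Gnk_Dn marg1 divff // gt_eqF // Dn_onevec_gt0. Qed.

Let S_gt0 t : S t -> 0 < t.
Proof.
rewrite /S /= => h; rewrite ltNge; apply/negP => t0; move: h.
by rewrite Gnk_Dn Dn_marg_le0 // mul0r leNgt u0.
Qed.

Let lbS : lbound S 0.
Proof. by move=> t /S_gt0 /ltW. Qed.

Let neS : S !=set0. Proof. by exists 1. Qed.

Let QE : Q u ord0 k = inf S.
Proof. by rewrite mxE leNgt u0. Qed.

Lemma Gnk_inv_Q : Gnk_inv P X Z Xs Zs A n k w (u ord0 k) = (Q u ord0 k)%:E.
Proof. by rewrite QE -ereal_inf_EFin //; exists 0. Qed.

Lemma sample_quantile_itv : 0 <= Q u ord0 k <= 1.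
Proof.
rewrite QE lb_le_inf //=; apply: ge_inf S1; by exists 0.
Qed.

Lemma Gnk_above_quantile t : Q u ord0 k < t -> u ord0 k <= G n k w t.
Proof.
rewrite QE => ht.
have [|s Ss st] := @inf_adherent R S (t - inf S) _ (conj neS (ex_intro _ 0 lbS)).
  by rewrite subr_gt0.
by apply: le_trans Ss _; apply: Gnk_nondecreasing; lra.
Qed.

Lemma Gnk_below_quantile t : t < Q u ord0 k -> G n k w t < u ord0 k.
Proof.
rewrite QE => ht; rewrite ltNge; apply/negP => h.
have : inf S <= t by apply: ge_inf h; exists 0.
by rewrite leNgt ht.
Qed.

End Coordinate.

Lemma sample_quantile_cube u : unit_cube u -> unit_cube (Q u).
Proof.
move=> cu k; have /andP[h0 h1] := cu k.
have [u0|u0] := ltP 0 (u ord0 k); first exact: sample_quantile_itv.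
by rewrite mxE u0 lexx ler01.
Qed.

Lemma Dbarn_quantile u : unit_cube u -> Dbarn P X Z Xs Zs A n u w = Dn n (Q u) w.
Proof.
move=> cu; rewrite /Dbarn /Defs.Dn; congr (_ * _); apply: eq_bigr => i _.
congr (nat_of_bool _)%:R; rewrite andbC [RHS]andbC.
case hA : (Zs i w \in A) => //=; apply: eq_forallb => k.
have /andP[h0 h1] := cu k.
have [u0|u0] := ltP 0 (u ord0 k); first by rewrite Gnk_inv_Q // lee_fin.
(* On this face both indicators vanish: no real lies below minus infinity, and [U_{i,k} <= 0] is
   excluded by [posU]. *)
have uk : u ord0 k = 0 by apply/eqP; rewrite eq_le u0.
rewrite mxE uk lexx; have := posU k (ltn_ord i) hA; rewrite ltNge => /negbTE ->.
rewrite /Gnk_inv (_ : [set t | _] = setT) ?ereal_inf_real ?leeNy_eq //.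
apply/seteqP; split => // t _ /=; rewrite Gnk_Dn.
by rewrite divr_ge0 ?(ltW Dn_onevec_gt0) // /Defs.Dn mulr_ge0 ?invr_ge0 // sumr_ge0.
Qed.

(** Multiplied by [sqrt n * Dn 1], the inequality [u_k <= G t] reads [c <= b t + a t] with
    [b = sqrt n * pA] and [a t] the marginal process, so the quantile is a crossing point. *)
Lemma quantile_equation u k : unit_cube u ->
  `|Num.sqrt n%:R * pA * (Q u ord0 k - u ord0 k) +
    (alpha n (marg k (Q u ord0 k)) w - u ord0 k * alpha n (onevec R p) w)| <= om.
Proof.
move=> cu; have /andP[h0 h1] := cu k.
set s := Num.sqrt n%:R.
have s0 : 0 < s by rewrite sqrtr_gt0 ltr0n.
have [u0|u0] := ltP 0 (u ord0 k); last first.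
  have uk : u ord0 k = 0 by apply/eqP; rewrite eq_le u0.
  by rewrite mxE uk lexx alpha_marg0 mul0r !subr0 mulr0 addr0 normr0.
have /andP[Q0 Q1] := sample_quantile_itv h1 u0.
have N0 := Dn_onevec_gt0.
have aS t : 0 <= t <= 1 -> s * pA * t + alpha n (marg k t) w = s * Dn n (marg k t) w.
  by move=> ht; rewrite alpha_marg // -/s; ring.
have a1 : s * pA + alpha n (onevec R p) w = s * Dn n (onevec R p) w.
  by have := @aS 1; rewrite mulr1 marg1; apply; rewrite ler01 lexx.
set c := u ord0 k * (s * pA + alpha n (onevec R p) w).
set v := Q u ord0 k in Q0 Q1 *.
rewrite (_ : _ + _ = s * pA * v + alpha n (marg k v) w - c); last by rewrite /c; ring.
apply: (crossing_bound (a := fun t => alpha n (marg k t) w) (del := del)) => //.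
- by rewrite mulr_ge0 // ltW.
- by rewrite Q0.
- move=> x y hx hy xy; apply: modulus.
  + by move=> j; rewrite mxE; case: ifP => // _; rewrite ler01 lexx.
  + by move=> j; rewrite mxE; case: ifP => // _; rewrite ler01 lexx.
  + by move=> j; rewrite !mxE; case: ifP => // _; rewrite subrr normr0 ltW.
- move=> t vt t1; rewrite aS; last by apply/andP; split => //; lra.
  have := Gnk_above_quantile h1 u0 vt; rewrite Gnk_Dn ler_pdivlMr // => h.
  by rewrite /c a1 mulrCA ler_pM2l.
- by move=> _; rewrite marg1 a1 /c a1 ler_piMl // mulr_ge0 // ltW.
- move=> t t0 tv; rewrite aS; last by apply/andP; split => //; lra.
  have := Gnk_below_quantile u0 tv; rewrite Gnk_Dn ltr_pdivrMr // => h.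
  by rewrite /c a1 (mulrCA (u ord0 k)) ler_pM2l // ltW.
- by move=> _; rewrite alpha_marg0 /c a1; apply: mulr_ge0 => //; apply: mulr_ge0; exact: ltW.
Qed.

End Sample.

(** * Deterministic linearization at a fixed sample point *)

Section SampleBound.
Context (d : measure_display) (T : measurableType d) (R : realType)
  (P : probability T R) (p q : nat)
  (X : T -> 'rV[R]_p) (Z : T -> 'rV[R]_q)
  (Xs : nat -> T -> 'rV[R]_p) (Zs : nat -> T -> 'rV[R]_q) (A : set 'rV[R]_q).
Hypothesis iid : iid_copies P X Z Xs Zs.
Hypothesis borelA : borel_rV A.
Hypothesis pA0 : 0 < pA P Z A.
Hypothesis contF : forall k, continuous (Fcond P X Z A k).
Hypothesis hC : condC P X Z A.

Local Notation D := (Dfun P X Z A).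
Local Notation dD := (dD P X Z A).
Local Notation pA := (pA P Z A).
Local Notation alpha := (DDn P X Z Xs Zs A).
Local Notation U := (UAi P X Z Xs A).

Let rvXZ : random_vector (joint X Z). Proof. by case: iid. Qed.

Lemma Dfun_coord_lipschitz u k (a b : R) : unit_cube u -> 0 <= a <= 1 -> 0 <= b <= 1 ->
  `|D (setc u k a) - D (setc u k b)| <= pA * `|a - b|.
Proof.
move=> cu; wlog ab : a b / b <= a.
  move=> wl ha hb; have [h|/ltW h] := leP b a; first exact: wl.
  by rewrite distrC (distrC a); exact: wl.
move=> ha hb.
have le : le_rV (setc u k b) (setc u k a) by move=> j; rewrite !mxE; case: ifP.
rewrite !ger0_norm ?subr_ge0 //; last exact: (Dfun_le rvXZ).
have := Dfun_lipschitz rvXZ borelA pA0 contF (setc_cube k cu hb) (setc_cube k cu ha) le.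
rewrite (bigD1 k) //= big1 ?addr0 ?mxE ?eqxx // => j /negbTE jk.
by rewrite !mxE jk subrr.
Qed.

Lemma dD_bound k u : Vk k u -> `|dD k u| <= pA.
Proof.
apply: (coord_derivative_bound Dfun_coord_lipschitz) => k' u'.
by have [h _] := hC k'; exact: h.
Qed.

Lemma dD_mean_value u k (a b : R) : unit_cube u -> 0 < a < 1 -> 0 <= b <= 1 ->
  exists x, [/\ 0 < x < 1, `|x - a| <= `|b - a| &
    D (setc u k b) - D (setc u k a) = dD k (setc u k x) * (b - a)].
Proof.
apply: (coord_mean_value Dfun_coord_lipschitz) => k' u'.
by have [h _] := hC k'; exact: h.
Qed.

Lemma dD_unif_continuous (eta e : R) : 0 < eta -> 0 < e ->
  exists2 r : R, 0 < r & forall k u v, unit_cube u -> unit_cube v ->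
    eta <= u ord0 k <= 1 - eta -> eta <= v ord0 k <= 1 - eta ->
    (forall j, `|u ord0 j - v ord0 j| < r) -> `|dD k u - dD k v| < e.
Proof.
move=> eta0 e0.
have h k : exists r : R, 0 < r /\ forall u v, unit_cube u -> unit_cube v ->
    eta <= u ord0 k <= 1 - eta -> eta <= v ord0 k <= 1 - eta ->
    (forall j, `|u ord0 j - v ord0 j| < r) -> `|dD k u - dD k v| < e.
  have cD k' : {within Vk k', continuous (dD k')} by have [_] := hC k'.
  by have [r r0 hr] := coord_derivative_unif_continuous cD k eta0 e0; exists r.
have [f hf] := choice h.
have s0 : 0 <= \sum_k (f k)^-1.
  by apply: sumr_ge0 => k _; rewrite invr_ge0 ltW //; case: (hf k).
(* A positive number below every [f k], defined without a minimum over a possibly empty index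
   set. *)
exists (1 + \sum_k (f k)^-1)^-1; first by rewrite invr_gt0 ltr_wpDr.
move=> k u v cu cv hu hv uv; have [fk0 hk] := hf k; apply: hk => // j.
apply: lt_le_trans (uv j) _.
rewrite -[leRHS]invrK lef_pV2 ?posrE ?invr_gt0 ?ltr_wpDr //.
rewrite (bigD1 k) //= addrCA lerDl addr_ge0 //.
by apply: sumr_ge0 => i _; rewrite invr_ge0 ltW //; case: (hf i).
Qed.

Variables (n : nat) (w : T) (om del M eta e r rho : R).
Hypothesis n0 : (0 < n)%N.
Hypothesis nA0 : (0 < nA Zs A n w)%N.
Hypothesis om0 : 0 <= om.
Hypothesis eta0 : 0 < eta.
Hypothesis eta_del : eta <= del.
Hypothesis posU : forall i k, (i < n)%N -> Zs i w \in A -> 0 < U i k w.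
Hypothesis modulus : forall u v, unit_cube u -> unit_cube v ->
  (forall k, `|u ord0 k - v ord0 k| <= del) -> `|alpha n u w - alpha n v w| <= om.
Hypothesis bounded : forall u v, unit_cube u -> unit_cube v ->
  `|alpha n u w - alpha n v w| <= M.
Hypothesis unif : forall k u v, unit_cube u -> unit_cube v ->
    eta / 2 <= u ord0 k <= 1 - eta / 2 -> eta / 2 <= v ord0 k <= 1 - eta / 2 ->
    (forall j, `|u ord0 j - v ord0 j| < r) -> `|dD k u - dD k v| < e.
Hypothesis rho_del : rho <= del.
Hypothesis rho_r : rho < r.
Hypothesis rho_eta : rho <= eta / 2.
Hypothesis rate : 2 * M + om <= Num.sqrt n%:R * pA * rho.

Let del0 : 0 < del. Proof. exact: lt_le_trans eta_del. Qed.

Local Notation Q := (sample_quantile P X Z Xs Zs A n w).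
Let beta (u : 'rV[R]_p) (k : 'I_p) : R := alpha n (marg k (u ord0 k)) w - u ord0 k * alpha n (onevec R p) w.

Let s := Num.sqrt n%:R : R.
Let s0 : 0 < s. Proof. by rewrite sqrtr_gt0 ltr0n. Qed.

Lemma marg_cube k t : 0 <= t <= 1 -> unit_cube (marg k t : 'rV[R]_p).
Proof. by move=> ht j; rewrite mxE; case: ifP => // _; rewrite ler01 lexx. Qed.

Lemma onevec_cube : unit_cube (onevec R p).
Proof. by move=> j; rewrite mxE ler01 lexx. Qed.

(** A bound on increments bounds the process itself, because [alpha] vanishes at [marg k 0]; this is
    why some coordinate [k] must be given. *)
Lemma alpha_bound (k : 'I_p) u : unit_cube u -> `|alpha n u w| <= M.
Proof.
move=> cu; rewrite -[alpha n u w]subr0 -(alpha_marg0 iid borelA pA0 contF posU k).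
by apply: bounded => //; apply: marg_cube; rewrite lexx ler01.
Qed.

Let M0 (k : 'I_p) : 0 <= M.
Proof. exact: le_trans (normr_ge0 _) (alpha_bound k onevec_cube). Qed.

Lemma scaled_onevec_bound k (u : 'rV[R]_p) : unit_cube u -> `|u ord0 k * alpha n (onevec R p) w| <= M.
Proof.
move=> cu; have /andP[h0 h1] := cu k; have h := alpha_bound k onevec_cube.
by rewrite normrM (ger0_norm h0); apply: le_trans h; rewrite ler_piMl.
Qed.

Lemma quantile_close (u : 'rV[R]_p) k : unit_cube u -> `|Q u ord0 k - u ord0 k| <= rho.
Proof.
move=> cu.
have h := quantile_equation iid borelA pA0 contF n0 nA0 om0 del0 posU modulus k cu.
have cQ := sample_quantile_cube iid borelA pA0 n0 nA0 posU cu.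
have h1 := alpha_bound k (marg_cube k (cQ k)).
have h2 := scaled_onevec_bound k cu.
have sp : 0 < s * pA by rewrite mulr_gt0.
rewrite -(ler_pM2l sp); apply: le_trans rate.
rewrite -{1}(gtr0_norm sp) -normrM; move: h h1 h2; rewrite -/s.
move: (s * pA * _) (alpha n _ w) (u ord0 k * _) => x y z.
by rewrite !ler_norml => /andP[? ?] /andP[? ?] /andP[? ?]; apply/andP; split; lra.
Qed.

(** Linearized quantile equation: one [om] comes from the crossing, the other from replacing the
    quantile by [u_k] inside the process. *)
Lemma quantile_beta (u : 'rV[R]_p) k : unit_cube u ->
  `|s * pA * (Q u ord0 k - u ord0 k) + beta u k| <= 2 * om.
Proof.
move=> cu.
have h := quantile_equation iid borelA pA0 contF n0 nA0 om0 del0 posU modulus k cu.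
have cQ := sample_quantile_cube iid borelA pA0 n0 nA0 posU cu.
have : `|alpha n (marg k (Q u ord0 k)) w - alpha n (marg k (u ord0 k)) w| <= om.
  apply: modulus; try exact: marg_cube.
  move=> j; rewrite !mxE; case: ifP => _; last by rewrite subrr normr0 ltW.
  by have := quantile_close k cu; rewrite mxE => h1; apply: le_trans h1 rho_del.
move: h; rewrite /beta -/s.
move: (s * pA * _) (alpha n (marg k (Q u ord0 k)) w) (alpha n (marg k (u ord0 k)) w) (u ord0 k * _) => x y y' z.
by rewrite !ler_norml => /andP[? ?] /andP[? ?]; apply/andP; split; lra.
Qed.

Lemma beta_bound (u : 'rV[R]_p) k : unit_cube u -> `|beta u k| <= 2 * M.
Proof.
move=> cu; have h1 := alpha_bound k (marg_cube k (cu k)).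
have h2 := scaled_onevec_bound k cu.
apply: le_trans (ler_normB _ _) _; lra.
Qed.

(** The marginal process is close to 0 near the lower face and to [alpha 1] near the upper one; in
    both cases what remains is [alpha 1] times the distance to the face. *)
Lemma beta_boundary (u : 'rV[R]_p) k : unit_cube u ->
  (u ord0 k < eta) \/ (1 - eta < u ord0 k) -> `|beta u k| <= om + eta * M.
Proof.
move=> cu hu; have /andP[h0 h1] := cu k.
have b1 := alpha_bound k onevec_cube; have M0' := M0 k.
have ed := eta_del.
case: hu => hu.
- have m : `|alpha n (marg k (u ord0 k)) w - alpha n (marg k 0) w| <= om.
    apply: modulus; [exact: marg_cube | by apply: marg_cube; rewrite lexx ler01 |].
    move=> j; rewrite !mxE; case: ifP => _; last by rewrite subrr normr0 ltW.
    by rewrite subr0 ger0_norm //; exact: le_trans (ltW hu) eta_del.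
  rewrite (alpha_marg0 iid borelA pA0 contF posU k) subr0 in m.
  apply: le_trans (ler_normB _ _) _; apply: lerD => //.
  by rewrite normrM (ger0_norm h0); apply: ler_pM => //; exact: ltW.
- have m : `|alpha n (marg k (u ord0 k)) w - alpha n (onevec R p) w| <= om.
    apply: modulus; [exact: marg_cube | exact: onevec_cube |].
    move=> j; rewrite !mxE; case: ifP => _; last by rewrite subrr normr0 ltW.
    by rewrite ler_norml; apply/andP; split; lra.
  rewrite /beta (_ : _ - _ = (alpha n (marg k (u ord0 k)) w - alpha n (onevec R p) w)
    + (1 - u ord0 k) * alpha n (onevec R p) w); last by ring.
  apply: le_trans (ler_normD _ _) _; apply: lerD => //.
  rewrite normrM ger0_norm ?subr_ge0 //; apply: ler_pM => //; lra.
Qed.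

(* At the endpoints [dD] may be a junk limit; it only occurs multiplied by [beta]. *)
Lemma beta_endpoint (u : 'rV[R]_p) k : u ord0 k = 0 \/ u ord0 k = 1 -> beta u k = 0.
Proof.
rewrite /beta; case=> ->.
  by rewrite (alpha_marg0 iid borelA pA0 contF posU k) mul0r subrr.
by rewrite marg1 mul1r subrr.
Qed.

(** Within [eta] of a face, both terms are small separately, by the Lipschitz bound and the
    smallness of [beta]. Elsewhere the mean value theorem and uniform continuity of the derivative
    make them cancel. The point [x] carries the coordinates already replaced by quantiles. *)
Lemma coordinate_error (u x : 'rV[R]_p) k : unit_cube u -> unit_cube x ->
  (forall j, `|x ord0 j - u ord0 j| <= rho) -> 0 <= e ->
  `|s * (D (setc x k (Q u ord0 k)) - D (setc x k (u ord0 k))) + pA^-1 * (dD k u * beta u k)|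
  <= 4 * om + 2 * eta * M + 2 * e * M / pA.
Proof.
move=> cu cx xu e0.
have cQ := sample_quantile_cube iid borelA pA0 n0 nA0 posU cu.
have hQb := quantile_beta k cu; have hb := beta_bound k cu.
have hc := quantile_close k cu; have M0' := M0 k.
have om0' := om0; have et := eta0; have re := rho_eta.
have /andP[h0 h1] := cu k.
have eM0 : 0 <= 2 * e * M / pA by rewrite divr_ge0 ?mulr_ge0 // ltW.
have etaM : 0 <= eta * M by rewrite mulr_ge0 // ltW.
set v := Q u ord0 k in hQb hc *.
set b := beta u k in hQb hb *.
have boundary : (u ord0 k < eta) \/ (1 - eta < u ord0 k) ->
  `|s * (D (setc x k v) - D (setc x k (u ord0 k))) + pA^-1 * (dD k u * b)|
  <= 4 * om + 2 * eta * M + 2 * e * M / pA.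
  move=> hu; have hbb := beta_boundary cu hu; rewrite -/b in hbb.
  have t1 : `|s * (D (setc x k v) - D (setc x k (u ord0 k)))| <= 2 * om + `|b|.
    rewrite normrM (gtr0_norm s0).
    apply: (@le_trans _ _ (s * (pA * `|v - u ord0 k|))).
      by rewrite ler_pM2l //; apply: Dfun_coord_lipschitz => //; exact: cQ.
    rewrite mulrA -(gtr0_norm (mulr_gt0 s0 pA0)) -normrM.
    rewrite -[X in `|X|](addrK b); apply: le_trans (ler_normB _ _) _.
    by rewrite lerD2r.
  have t2 : `|pA^-1 * (dD k u * b)| <= `|b|.
    have [u00|un0] := eqVneq (u ord0 k) 0.
      by rewrite /b beta_endpoint ?mulr0 ?normr0 //; left.
    have [u10|un1] := eqVneq (u ord0 k) 1.
      by rewrite /b beta_endpoint ?mulr0 ?normr0 //; right.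
    have Vu : Vk k u by split => //; rewrite !lt_neqAle eq_sym un0 un1 h0 h1.
    have := dD_bound Vu => hd.
    rewrite mulrA normrM ler_piMl // normrM normfV (gtr0_norm pA0) mulrC.
    by rewrite ler_pdivrMr // mul1r.
  apply: le_trans (ler_normD _ _) _; lra.
have [hu|hu] := ltP (u ord0 k) eta; first by apply: boundary; left.
have [hu'|hu'] := ltP (1 - eta) (u ord0 k); first by apply: boundary; right.
have uin : 0 < u ord0 k < 1 by apply/andP; split; lra.
have [y [/andP[y0 y1] hy ->]] := dD_mean_value k cx uin (cQ k).
set z := setc x k y.
have cz : unit_cube z by apply: setc_cube => //; rewrite !ltW.
have zu j : `|z ord0 j - u ord0 j| <= rho.
  rewrite mxE; case: eqP => [->|_]; last exact: xu.
  exact: le_trans hy hc.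
have zk := zu k; rewrite ler_norml in zk; case/andP: zk => zk1 zk2.
(* Since [rho <= eta / 2], the point [z] remains in the slab of half width margin [eta / 2], where
   [unif] applies. *)
have du : `|dD k z - dD k u| < e.
  apply: unif => //; try (apply/andP; split; lra).
  by move=> j; exact: le_lt_trans (zu j) rho_r.
have Vz : Vk k z by apply: Vk_setc => //; rewrite y0.
have hd := dD_bound Vz.
rewrite -/v.
(* The first term carries the error of the linearized quantile equation, the second that of moving
   the derivative from [z] to [u]. *)
have -> : s * (dD k z * (v - u ord0 k)) + pA^-1 * (dD k u * b) =
   pA^-1 * dD k z * (s * pA * (v - u ord0 k) + b) - pA^-1 * (dD k z - dD k u) * b.
  by field; rewrite gt_eqF.
apply: le_trans (ler_normB _ _) _.
have t1 : `|pA^-1 * dD k z * (s * pA * (v - u ord0 k) + b)| <= 2 * om.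
  rewrite normrM; apply: le_trans hQb; rewrite ler_piMl //.
  by rewrite normrM normfV (gtr0_norm pA0) mulrC ler_pdivrMr // mul1r.
have t2 : `|pA^-1 * (dD k z - dD k u) * b| <= 2 * e * M / pA.
  rewrite -mulrA mulrC normrM normfV (gtr0_norm pA0) ler_wpM2r ?invr_ge0 ?(ltW pA0) //.
  rewrite normrM mulrAC [2 * M * e]mulrC; apply: ler_pM => //; exact: ltW.
lra.
Qed.

Definition mix (u v : 'rV[R]_p) (m : nat) : 'rV[R]_p :=
  \row_j (if (j < m)%N then v ord0 j else u ord0 j).

Lemma sample_error u : unit_cube u -> 0 <= e ->
  `|DDbarn P X Z Xs Zs A n u w - DDtilden P X Z Xs Zs A n u w| <=
  om + p%:R * (4 * om + 2 * eta * M + 2 * e * M / pA).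
Proof.
move=> cu e0.
have cQ := sample_quantile_cube iid borelA pA0 n0 nA0 posU cu.
(* Replace the coordinates of [u] by quantiles one at a time; [mix u (Q u) k] has the first [k]
   replaced. *)
have tel : D (Q u) - D u = \sum_(k < p)
    (D (setc (mix u (Q u) k) k (Q u ord0 k)) - D (setc (mix u (Q u) k) k (u ord0 k))).
  have := telescope_sumr (fun m => D (mix u (Q u) m)) (leq0n p).
  rewrite big_mkord (_ : mix u (Q u) p = Q u); last first.
    by apply/rowP => j; rewrite mxE ltn_ord.
  rewrite (_ : mix u (Q u) 0 = u); last by apply/rowP => j; rewrite mxE.
  move=> <-; apply: eq_bigr => k _; congr (D _ - D _); apply/rowP => j; rewrite !mxE.
    by rewrite ltnS leq_eqVlt -val_eqE /=; case: eqP => // /val_inj ->.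
  by case: eqP => // ->; rewrite ltnn.
rewrite /DDbarn /DDtilden (Dbarn_quantile iid borelA pA0 n0 nA0 posU cu) -/s.
rewrite (_ : _ - _ = (alpha n (Q u) w - alpha n u w) + \sum_(k < p)
  (s * (D (setc (mix u (Q u) k) k (Q u ord0 k)) - D (setc (mix u (Q u) k) k (u ord0 k)))
   + pA^-1 * (dD k u * beta u k))); last first.
  rewrite big_split /= -!mulr_sumr -tel /DDn -/s.
  by rewrite /beta /ukone /marg; ring.
apply: le_trans (ler_normD _ _) _; apply: lerD.
  by apply: modulus => // k; exact: le_trans (quantile_close k cu) rho_del.
apply: le_trans (ler_norm_sum _ _ _) _.
rewrite mulr_natl -[X in _ <= _ *+ X]card_ord -sumr_const; apply: ler_sum => k _.
have rho0 : 0 <= rho := le_trans (normr_ge0 _) (quantile_close k cu).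
apply: coordinate_error => // j; rewrite mxE; case: ifP => _.
- exact: cQ.
- exact: cu.
- exact: quantile_close.
- by rewrite subrr normr0.
Qed.

End SampleBound.

(** * Choice of the constants and conclusion *)

Theorem theorem1 (d : measure_display) (T : measurableType d) (R : realType)
  (P : probability T R) (p q : nat)
  (X : T -> 'rV[R]_p) (Z : T -> 'rV[R]_q)
  (Xs : nat -> T -> 'rV[R]_p) (Zs : nat -> T -> 'rV[R]_q)
  (A : set 'rV[R]_q) :
  iid_copies P X Z Xs Zs ->
  borel_rV A ->
  0 < pA P Z A ->
  (forall k : 'I_p, continuous (Fcond P X Z A k)) ->
  condC P X Z A ->
  sup_cvg_in_prob0 P
    (fun n u w => DDbarn P X Z Xs Zs A n u w - DDtilden P X Z Xs Zs A n u w).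
Proof.
move=> iid borelA pA0 contF hC eps delta eps0 delta0.
(* Without coordinates the two processes coincide; otherwise a coordinate [k0] is at hand for
   [alpha_bound]. *)
have [p0|p0] := posnP p.
  subst p; exists 0%N => // n _; exists set0; rewrite measure0; split => //.
  split; last by rewrite lee_fin ltW.
  move=> w [u _] /=; rewrite /DDbarn /DDtilden big_ord0 mulr0 subr0.
  rewrite (_ : Dbarn _ _ _ _ _ _ n u w = Dn P X Z Xs Zs A n u w); last first.
    rewrite /Dbarn /Dn; congr (_ * _); apply: eq_bigr => i _.
    by congr (nat_of_bool (_ && _))%:R; apply/forallP/forallP => _ [].
  by rewrite subrr normr0 ltNge (ltW eps0).
have k0 : 'I_p := Ordinal p0.
pose c : R := p.+1%:R; have c0 : 0 < c by rewrite ltr0n.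
(* The final error is at most [th + p * (4 th + th + th)], which is below [8 (p + 1) th = eps]. *)
pose th := eps / (8 * c); have th0 : 0 < th by rewrite divr_gt0 // mulr_gt0.
have [K K0 good] := empirical_good iid borelA pA0 contF delta0.
(* This is the modulus at level 0, where the whole cube counts as one neighbourhood, with
   [tau <= 1]. *)
pose M := 10 * K + 2; have M0 : 0 < M by rewrite /M; lra.
pose tau := Num.min (th / 4) 1.
have tau0 : 0 < tau by rewrite lt_min ltr01 andbT divr_gt0.
have [tau1 tau2] : tau <= th / 4 /\ tau <= 1.
  by rewrite /tau !ge_min !lexx orbT.
(* Together with [2 * tau <= th / 2], the modulus at scale [2^-j1] is at most [th]. *)
have [j1 hj1] : exists j1, 10 * K * (3 / 4) ^+ j1 <= th / 2.
  have [m hm] := @pow_eventually_ge R (1 / 3) (20 * K / th) ltac:(lra).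
  exists m; have := hm m (leqnn m).
  have -> : (1 + 1 / 3 : R) ^+ m = ((3 / 4) ^+ m)^-1.
    by rewrite -exprVn; congr (_ ^+ _); field.
  have : 0 < (3 / 4 : R) ^+ m by rewrite exprn_gt0.
  move: ((3 / 4) ^+ m) => y y0.
  rewrite ler_pdivrMr // [y^-1 * th]mulrC ler_pdivlMr //; lra.
pose del : R := 2^-1 ^+ j1.
have del0 : 0 < del by rewrite exprn_gt0 // invr_gt0.
have del1 : del <= 1 by rewrite exprn_ile1 // ?invr_ge0 // invf_le1 // ler1n.
pose eta := Num.min del (th / (2 * M)).
have eta0 : 0 < eta by rewrite lt_min del0 divr_gt0 // mulr_gt0.
have [eta_del etaM] : eta <= del /\ eta <= th / (2 * M).
  by rewrite /eta !ge_min !lexx orbT.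
pose e := th * pA P Z A / (2 * M).
have e0 : 0 < e by apply: divr_gt0; apply: mulr_gt0.
have [|r r0 unif] := @dD_unif_continuous _ _ _ P p q X Z A hC (eta / 2) e _ e0.
  by rewrite divr_gt0.
pose rho := Num.min del (Num.min (r / 2) (eta / 2)).
have rho0 : 0 < rho by rewrite !lt_min del0 !divr_gt0.
have [rho_del rho_r rho_eta] : [/\ rho <= del, rho < r & rho <= eta / 2].
  split; rewrite /rho ?ge_min ?gt_min ?lexx ?orbT //.
  by rewrite [r / 2 < r](_ : _ = true) ?orbT //; lra.
(* The hypothesis [rate] is exactly [x <= sqrt n]. *)
pose x := (2 * M + th) / (pA P Z A * rho).
have x0 : 0 < x by rewrite divr_gt0 ?mulr_gt0 //; lra.
have big : \forall n \near \oo, (0 < n)%N /\ x <= Num.sqrt n%:R.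
  exists (Num.bound (x ^+ 2)).+1 => // n /= hn; split; first exact: leq_ltn_trans hn.
  have h : x ^+ 2 <= n%:R.
    apply: le_trans (ltW (archi_boundP (exprn_ge0 2 (ltW x0)))) _.
    by rewrite ler_nat ltnW.
  by rewrite -(ger0_norm (ltW x0)) -sqrtr_sqr ler_wsqrtr.
near=> n.
have [n0 hx] : (0 < n)%N /\ x <= Num.sqrt n%:R by near: n.
have : exists E : set T,
  [/\ measurable E, (P E <= delta%:E)%E & forall w, ~ E w ->
    (forall j u v, (j <= j1)%N -> unit_cube u -> unit_cube v ->
      (forall k, `|u ord0 k - v ord0 k| <= 2^-1 ^+ j) ->
      `|DDn P X Z Xs Zs A n u w - DDn P X Z Xs Zs A n v w| <= 10 * K * (3 / 4) ^+ j + 2 * tau) /\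
    (forall i k, (i < n)%N -> Zs i w \in A -> 0 < UAi P X Z Xs A i k w)].
  by near: n; exact: good.
case=> E [mE pE hE]; exists E; split => //; split => //.
move=> w /= [u cu]; apply: contraPP => nE.
have [mod posU] := hE w nE.
apply/negP; rewrite -leNgt.
have modulus u' v' : unit_cube u' -> unit_cube v' ->
    (forall k, `|u' ord0 k - v' ord0 k| <= del) ->
    `|DDn P X Z Xs Zs A n u' w - DDn P X Z Xs Zs A n v' w| <= th.
  by move=> cu' cv' h; apply: le_trans (mod j1 u' v' (leqnn _) cu' cv' h) _; lra.
have bounded u' v' : unit_cube u' -> unit_cube v' ->
    `|DDn P X Z Xs Zs A n u' w - DDn P X Z Xs Zs A n v' w| <= M.
  move=> cu' cv'; apply: le_trans (mod 0%N u' v' (leq0n _) cu' cv' _) _.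
    move=> k; have /andP[? ?] := cu' k; have /andP[? ?] := cv' k.
    by rewrite expr0 ler_norml; apply/andP; split; lra.
  by rewrite expr0 /M; lra.
have rate : 2 * M + th <= Num.sqrt n%:R * pA P Z A * rho.
  by rewrite -mulrA -ler_pdivrMr ?mulr_gt0.
(* If no sample point fell in [A], then [alpha 1 = - sqrt n * pA], of modulus at most [M]; but
   [rate] and [rho <= 1] give [sqrt n * pA >= 2 M + th]. *)
have nA0 : (0 < nA Zs A n w)%N.
  have := alpha_bound iid borelA pA0 contF posU bounded k0 (@onevec_cube R p).
  rewrite /DDn (Dn_onevec iid borelA pA0) -(@marg1 R p k0) (Dfun_marg _ borelA pA0 contF) ?ler01 ?lexx //; last by case: iid.
  rewrite lt0n; case: eqP => // ->; rewrite !mulr0 mulr1 sub0r mulrN normrN => h.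
  have sp : 0 <= Num.sqrt n%:R * pA P Z A by rewrite mulr_ge0 ?sqrtr_ge0 // ltW.
  rewrite ger0_norm // in h.
  have : Num.sqrt n%:R * pA P Z A * rho <= Num.sqrt n%:R * pA P Z A.
    by rewrite ler_piMr //; lra.
  lra.
apply: le_trans (sample_error iid borelA pA0 contF hC n0 nA0 (ltW th0) eta0 eta_del
  posU modulus bounded unif rho_del rho_r rho_eta rate cu (ltW e0)) _.
have h1 : 2 * eta * M <= th.
  by rewrite ler_pdivlMr ?mulr_gt0 // in etaM; lra.
have h2 : 2 * e * M / pA P Z A = th.
  by rewrite /e; field; rewrite !gt_eqF.
have h3 : 8 * c * th = eps by rewrite mulrC divfK // gt_eqF // mulr_gt0.
have h4 : c = p%:R + 1 by rewrite /c -natr1.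
have h5 : (p%:R : R) * (4 * th + 2 * eta * M + 2 * e * M / pA P Z A) <= p%:R * (6 * th).
  by rewrite ler_wpM2l //; lra.
have h6 : (0 : R) <= p%:R * th by rewrite mulr_ge0 // ltW.
rewrite h4 in h3; lra.
Unshelve. all: by end_near. Qed.
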